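(* Fix $\beta_0\in(0,1)$ and let $\gamma_0:=\gamma(\beta_0)$, where $\gamma_0>-\infty$. Assume that there exist a stationary policy $u_0\in\Pi'$, a state $x_0\in E$, and an action $a_0\in U$ such that: 1. $\rho_{u_0}(\beta_0)<\min_{u\in\Pi',\,u\ne u_0}\rho_u(\beta_0)$; 2. $a_0\ne u_0(x_0)$, $D_{u_0,x_0,a_0}(\beta_0,\gamma_0)=0$, $D_{u_0,x_0,a_0}(\beta_0,\gamma)>0$ for $\gamma\in(\gamma_0,0]$, and $D_{u_0,x,a}(\beta_0,\gamma)>0$ for all $\gamma\in[\gamma_0,0]$ and all $(x,a)\in E\times U$ such that $a\ne u_0(x)$ and $(x,a)\ne(x_0,a_0)$; 3. $\partial_\gamma D_{u_0,x_0,a_0}(\beta_0,\gamma_0)\ne0$. Then there exist a neighborhood $V$ of $\beta_0$ and a real-analytic function $\widehat\gamma\colon V\to(-\infty,0)$ such that $\widehat\gamma(\beta_0)=\gamma_0$ and $\widehat\gamma(\beta)=\gamma(\beta)$ for $\beta\in V$. In particular, $\beta\mapsto\gamma(\beta)$ is continuous and real analytic in a neighborhood of $\beta_0$.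
   Context: Setting (finite discounted risk-sensitive MDP). $E=\{x_1,\dots,x_k\}$ is a finite state space and $U=\{\tilde u_1,\dots,\tilde u_l\}$ a finite action space (both nonempty); every action is available in every state. For $a\in U$, $P^a=[p_a(x_i,x_j)]_{i,j=1}^k$ is a transition probability matrix. $c\colon E\times U\to\mathbb{R}$ is a fixed running reward. $(X_n)_{n\ge 0}$ is the canonical state process. A policy is a sequence $\pi=(a_n)_{n\ge0}$, where $a_n$ is a $U$-valued function of $(X_0,\dots,X_n)$; $\Pi$ is the set of all policies. $\mathbb{E}_x^\pi$ is the expectation under the law of the process with $X_0=x$ and $\mathbb{P}(X_{n+1}=y\mid X_0,\dots,X_n)=p_{a_n}(X_n,y)$. $\Pi''\subset\Pi$ is the set of Markov policies, identified with sequences $(u_n)_{n\ge0}$, $u_n\colon E\to U$, via $a_n=u_n(X_n)$. $\Pi'\subset\Pi''$ is the set of stationary Markov policies, identified with functions $u\colon E\to U$, via $a_n=u(X_n)$ for all $n$. For $\gamma\in\mathbb{R}$, $\beta\in(0,1)$, $x\in E$, $\pi=(a_i)_{i\ge 0}\in\Pi$, put $$J_\gamma(x,\pi;\beta):=\begin{cases}\frac1\gamma\ln\mathbb{E}_x^\pi\big[e^{\gamma\sum_{i=0}^\infty\beta^i c(X_i,a_i)}\big],&\gamma\ne0,\\ \mathbb{E}_x^\pi\big[\sum_{i=0}^\infty\beta^i c(X_i,a_i)\big],&\gamma=0.\end{cases}$$ $\Pi^*(\beta,\gamma)$ is the set of Markov policies $\pi\in\Pi''$ that are optimal for every starting point,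 i.e. $J_\gamma(x,\pi;\beta)=\sup_{\pi'\in\Pi}J_\gamma(x,\pi';\beta)$ for all $x\in E$. Define, for $\beta\in(0,1)$, $\gamma(\beta):=\inf\{r<0:\ \text{there exists } u\in\Pi' \text{ with } u\in\Pi^*(\beta,\gamma)\text{ for all }\gamma\in[r,0]\}\in[-\infty,0)$. For $u\in\Pi'$, $x\in E$, $a\in U$ let $\pi^{x,a,u}:=(v^{x,a},u,u,\dots)\in\Pi''$, where $v^{x,a}\colon E\to U$ is any decision rule with $v^{x,a}(x)=a$ (its values at other states are irrelevant when the initial state is $x$). The one-step-deviation difference is $$D_{u,x,a}(\beta,\gamma):=J_\gamma(x,u;\beta)-J_\gamma(x,\pi^{x,a,u};\beta),\qquad(\beta,\gamma)\in(0,1)\times\mathbb{R}.$$ For $u\in\Pi'$ and $\beta\in(0,1)$ put $$\rho_u(\beta):=\inf\{r\le0:\ D_{u,x,a}(\beta,\gamma)\ge0\ \text{for all }x\in E,\ a\in U,\ \gamma\in[r,0]\},$$ with the infimum of the empty set equal to $+\infty$, so $\rho_u(\beta)\in[-\infty,0]\cup\{+\infty\}$. *)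

(* Defs.v *)
From HB Require Import structures.
From mathcomp Require Import all_boot all_order all_algebra.
From mathcomp Require Import all_classical all_reals all_analysis.
Import Order.TTheory GRing.Theory Num.Theory.
Import numFieldNormedType.Exports.

Set Implicit Arguments.
Unset Strict Implicit.
Unset Printing Implicit Defensive.

Local Open Scope classical_set_scope.
Local Open Scope ring_scope.

Record mdp (R : realType) (E U : finType) := Mdp {
  state_gt0 : (0 < #|E|)%N;
  action_gt0 : (0 < #|U|)%N;
  trans : U -> E -> E -> R;
  trans_ge0 : forall a x y, 0 <= trans a x y;
  trans_sum1 : forall a x, \sum_(y : E) trans a x y = 1;
  reward : E -> U -> R
}.

(* The action chosen at time n is a function of (X_0, ..., X_n). *)
Definition policy (E U : finType) := forall n : nat, n.+1.-tuple E -> U.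

Definition markov (E U : finType) (v : nat -> E -> U) : policy E U :=
  fun n h => v n (tnth h ord_max).

Definition stationary (E U : finType) (u : {ffun E -> U}) : nat -> E -> U :=
  fun _ => u.

Definition history (E : finType) (w : nat -> E) (n : nat) : n.+1.-tuple E :=
  [tuple w i | i < n.+1].

(* The trajectory space depends on M only because a measurableType has to be
   pointed: nonemptiness of E provides the (otherwise irrelevant) point. *)
Definition trajectory (R : realType) (E U : finType) (M : mdp R E U) :=
  nat -> E.

Section trajectory_instances.
Context (R : realType) (E U : finType) (M : mdp R E U).
HB.instance Definition _ := Choice.copy (trajectory M) (nat -> E).
HB.instance Definition _ := isPointed.Build (trajectory M)
  (fun _ => enum_val (Ordinal (state_gt0 M))).
End trajectory_instances.

Definition coordinate_events (R : realType) (E U : finType) (M : mdp R E U) :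
    set (set (trajectory M)) :=
  [set A | exists n y, A = [set w | w n = y]].

Arguments coordinate_events {R E U} M.

(* E^nat with the sigma-algebra generated by the coordinates. *)
Notation canonical_space M := (g_sigma_algebraType (coordinate_events M)).

(* P(X_0 = x) = 1 and P(X_{n+1} = y | X_0, ..., X_n) = p_{a_n}(X_n, y), the
   latter multiplied out so as to cover histories of probability 0. *)
Definition is_law (R : realType) (E U : finType) (M : mdp R E U)
    (x : E) (pi : policy E U) (P : probability (canonical_space M) R) :=
  P [set w | w 0%N = x] = 1%E /\
  forall n (h : n.+1.-tuple E) (y : E),
    P [set w | history w n = h /\ w n.+1 = y] =
    (P [set w | history w n = h] *
     (trans M (pi n h) (tnth h ord_max) y)%:E)%E.

(* Existence of the law. The process is realized on [0, 1] under the uniform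
   distribution by splitting, at time n, the interval attached to the current
   history into consecutive intervals with lengths proportional to the
   transition probabilities. *)
Section law_existence.
Context (R : realType) (E U : finType) (M : mdp R E U).
Variables (x : E) (pi : policy E U).

Let kap n (e : nat -> E) (y : E) : R := trans M (pi (history e n)) (e n) y.

Let psum n e (k : nat) : R :=
  \sum_(i < #|E| | (i < k)%N) kap n e (enum_val i).

Let W := fix W n (e : nat -> E) : R :=
  if n is m.+1 then W m e * kap m e (e m.+1) else 1.

Let L := fix L n (e : nat -> E) : R :=
  if n is m.+1 then L m e + W m e * psum m e (enum_rank (e m.+1)) else 0.

Let agree n (e e' : nat -> E) := forall i, (i <= n)%N -> e i = e' i.

Let agreeW m n e e' : (m <= n)%N -> agree n e e' -> agree m e e'.
Proof. by move=> mn H i im; apply: H; exact: leq_trans mn. Qed.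

Let agree_history n e e' : agree n e e' -> history e n = history e' n.
Proof.
by move=> H; apply: eq_from_tnth => i; rewrite !tnth_mktuple H// -ltnS.
Qed.

Let history_agree n e e' : history e n = history e' n -> agree n e e'.
Proof.
move=> H i; rewrite -ltnS => ilt.
by have := congr1 (fun t => tnth t (Ordinal ilt)) H; rewrite !tnth_mktuple.
Qed.

Let agree_kap n e e' y : agree n e e' -> kap n e y = kap n e' y.
Proof. by move=> H; rewrite /kap (agree_history H) H. Qed.

Let agree_psum n e e' k : agree n e e' -> psum n e k = psum n e' k.
Proof. by move=> H; apply: eq_bigr => i _; exact: agree_kap. Qed.

Let agreeWd n e e' : agree n e e' -> W n e = W n e'.
Proof.
elim: n => //= n IH H.
by rewrite (H n.+1)// (agree_kap _ (agreeW (leqnSn n) H))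
  (IH (agreeW (leqnSn n) H)).
Qed.

Let agreeL n e e' : agree n e e' -> L n e = L n e'.
Proof.
elim: n => //= n IH H; have Hn := agreeW (leqnSn n) H.
by rewrite (H n.+1)// (agree_psum _ Hn) (IH Hn) (agreeWd Hn).
Qed.

Let kap_ge0 n e y : 0 <= kap n e y. Proof. exact: trans_ge0. Qed.

Let W_ge0 n e : 0 <= W n e.
Proof. by elim: n => //= n IH; rewrite mulr_ge0. Qed.

Let psum0 n e : psum n e 0 = 0. Proof. exact: big_pred0. Qed.

Let psum_card n e : psum n e #|E| = 1.
Proof.
rewrite /psum (eq_bigl predT); last by move=> i; rewrite ltn_ord.
rewrite -(trans_sum1 M (pi (history e n)) (e n)).
rewrite [RHS](reindex (fun i : 'I_#|E| => @enum_val E E i))//.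
exact: onW_bij (enum_val_bij E).
Qed.

Let psumS n e (y : E) :
  psum n e (enum_rank y).+1 = psum n e (enum_rank y) + kap n e y.
Proof.
rewrite /psum (bigD1 (enum_rank y))//= enum_rankK addrC; congr (_ + _).
apply: eq_bigl => i; rewrite ltnS ltn_neqAle andbC; congr andb.
Qed.

Let psum_le n e j k : (j <= k)%N -> psum n e j <= psum n e k.
Proof.
move=> jk; rewrite /psum [leLHS]big_mkcond [leRHS]big_mkcond.
apply: ler_sum => i _; case: ltnP => [/leq_trans/(_ jk) ->//|_].
by case: ifP.
Qed.

Let cell n e t := L n e <= t < L n e + W n e.

Let upd (e : nat -> E) n y : nat -> E := fun i => if i == n then y else e i.

Let upd_agree e n y : agree n e (upd e n.+1 y).
Proof. by move=> i; rewrite /upd -ltnS; case: eqP => // ->; rewrite ltnn. Qed.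
Arguments upd_agree : clear implicits.

Let cellS n e y t : cell n.+1 (upd e n.+1 y) t =
  (L n e + W n e * psum n e (enum_rank y) <= t
     < L n e + W n e * psum n e (enum_rank y).+1).
Proof.
have H := upd_agree e n y.
rewrite /cell /= -(agreeL H) -(agreeWd H) -(agree_psum _ H) -(agree_kap _ H).
by rewrite /upd eqxx psumS mulrDr addrA.
Qed.

Let cell_next n e t : cell n e t -> exists y, cell n.+1 (upd e n.+1 y) t.
Proof.
move=> /andP[Lt tW].
have ex : exists k, t < L n e + W n e * psum n e k.
  by exists #|E|; rewrite psum_card mulr1.
case: (ex_minnP ex) => -[|k]; first by rewrite psum0 mulr0 addr0 ltNge Lt.
move=> tk min.
have kE : (k < #|E|)%N by apply: min; rewrite psum_card mulr1.
exists (enum_val (Ordinal kE)); rewrite cellS enum_valK/= tk andbT leNgt.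
by apply/negP => /min; rewrite ltnn.
Qed.

Let cell_uniq n e y z t :
  cell n.+1 (upd e n.+1 y) t -> cell n.+1 (upd e n.+1 z) t -> y = z.
Proof.
have key (a b : E) : cell n.+1 (upd e n.+1 a) t ->
    cell n.+1 (upd e n.+1 b) t -> (enum_rank a < enum_rank b)%N -> False.
  rewrite !cellS => /andP[_ ta] /andP[tb _] ab.
  have := le_lt_trans tb ta; rewrite ltrD2l ltNge => /negP; apply.
  by rewrite ler_wpM2l// psum_le.
move=> cy cz; apply: enum_rank_inj; apply/val_inj => /=.
have [yz|zy|//] := ltngtP (enum_rank y) (enum_rank z).
- by case: (key _ _ cy cz yz).
- by case: (key _ _ cz cy zy).
Qed.

Let cell_agree n e e' t : agree n e e' -> cell n e t = cell n e' t.
Proof. by move=> H; rewrite /cell (agreeL H) (agreeWd H). Qed.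

Let cell_pred n e t : cell n.+1 e t -> cell n e t.
Proof.
have H : agree n.+1 e (upd e n.+1 (e n.+1)).
  by move=> i _; rewrite /upd; case: eqP => // ->.
rewrite (cell_agree _ H) cellS => /andP[le lt]; apply/andP; split.
  by apply: le_trans le; rewrite lerDl mulr_ge0// -(psum0 n e) psum_le.
apply: lt_le_trans lt _; rewrite lerD2l ler_piMr//.
by rewrite -(psum_card n e) psum_le.
Qed.

Let next n e t := xget x [set y | cell n.+1 (upd e n.+1 y) t].

Let code_aux t := fix code n : nat -> E :=
  if n is m.+1 then upd (code m) m.+1 (next m (code m) t) else fun=> x.

Let code (t : R) : trajectory M :=
  fun n => if 0 <= t < 1 then code_aux t n n else x.

Let code_auxP n t : 0 <= t < 1 -> cell n (code_aux t n) t.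
Proof.
move=> t01; elim: n => [|n IH]; first by rewrite /cell add0r.
by have [y cy] := cell_next IH; rewrite /= /next; case: xgetP => // /(_ y).
Qed.

Let code_agree n t : 0 <= t < 1 -> agree n (code_aux t n) (code t).
Proof.
move=> t01; elim: n => [|n IH] i; first by case: i => //= _; rewrite /code t01.
rewrite leq_eqVlt => /predU1P[->|]; first by rewrite /code t01.
by rewrite ltnS => im; rewrite -(IH _ im) /= -(upd_agree _ _ _ _ im).
Qed.

Let code_cell n (e : nat -> E) t : 0 <= t < 1 -> e 0%N = x ->
  agree n (code t) e <-> cell n e t.
Proof.
move=> t01 ex; split => [H|].
  have H' : agree n (code_aux t n) e by move=> i im; rewrite (code_agree t01 im) H.
  by rewrite -(cell_agree _ H'); exact: code_auxP.
elim: n => [_ [|i]//= _|n IH cSe]; first by rewrite /code t01 ex.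
have H := IH (cell_pred cSe) => i.
rewrite leq_eqVlt => /predU1P[->|]; last by rewrite ltnS => /H.
rewrite -[e n.+1](_ : upd e n.+1 (e n.+1) n.+1 = _); last by rewrite /upd eqxx.
have c1 : cell n.+1 (upd e n.+1 (e n.+1)) t.
  rewrite -(@cell_agree _ e)// => j _; rewrite /upd; by case: eqP => // ->.
have c2 : cell n.+1 (upd e n.+1 (code t n.+1)) t.
  rewrite -(@cell_agree _ (code_aux t n.+1)); first exact: code_auxP.
  move=> j jn; rewrite (code_agree t01 jn) /upd; case: eqP => [->//|/eqP jn1].
  by apply: H; rewrite -ltnS ltn_neqAle jn1.
by rewrite /upd eqxx (cell_uniq c2 c1).
Qed.

Let hist_fun n (h : n.+1.-tuple E) : nat -> E := nth x h.

Let history_hist_fun n (h : n.+1.-tuple E) : history (hist_fun h) n = h.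
Proof. by apply: eq_from_tnth => i; rewrite tnth_mktuple (tnth_nth x). Qed.

Let code_preimage n (e : nat -> E) : e 0%N = x ->
  `[0, 1[ `&` [set t | history (code t) n = history e n] =
  `[L n e, L n e + W n e[%classic.
Proof.
move=> ex; apply/seteqP; split=> t /=; rewrite !in_itv/=.
  by move=> [t01 /history_agree/code_cell]; exact.
move=> ct; suff t01 : 0 <= t < 1.
  by split=> //; apply: agree_history; apply/code_cell.
have : cell 0 e t by elim: n ct => // n IH /cell_pred/IH.
by rewrite /cell/= add0r.
Qed.

Let measurable_code_history n (h : n.+1.-tuple E) :
  measurable (`[0, 1[ `&` [set t : R | history (code t) n = h]).
Proof.
have [hx|hx] := eqVneq (hist_fun h 0%N) x.
  by rewrite -(history_hist_fun h) code_preimage//; exact: measurable_itv.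
rewrite (_ : _ `&` _ = set0)//; apply/seteqP; split=> // t [/=].
rewrite in_itv/= => t01 th; move/eqP: hx; apply.
have : agree n (code t) (hist_fun h).
  by apply: history_agree; rewrite history_hist_fun.
by move=> /(_ 0%N (leq0n _)) <-; rewrite /code t01.
Qed.

Let measurable_code : 
  measurable_fun [set: measurableTypeR R] (code : _ -> canonical_space M).
Proof.
apply: (@measurability _ _ _ (canonical_space M) _ _ (coordinate_events M)).
  by [].
move=> _ [_ [n [y ->]] <-]; rewrite setTI.
rewrite -(setIT (_ @^-1` _)) -(setvU `[0, 1[%classic) setIUr.
apply: measurableU.
  have [->|yx] := eqVneq y x.
    rewrite setIidr; first by apply: measurableC; exact: measurable_itv.
    by move=> t /=; rewrite in_itv/= => /negP/negbTE; rewrite /code => ->.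
  rewrite (_ : _ `&` _ = set0)//; apply/seteqP; split=> // t [/=].
  rewrite in_itv/= /code => /[swap] /negP/negbTE -> xy.
  by rewrite xy eqxx in yx.
rewrite (_ : _ `&` _ = \bigcup_(h in [set h : n.+1.-tuple E | tnth h ord_max = y])
    (`[0, 1[ `&` [set t : R | history (code t) n = h])).
  by apply: fin_bigcup_measurable => // h _; exact: measurable_code_history.
apply/seteqP; split=> [t [/= ty t01]|t [h /= hy [t01 th]]].
  by exists (history (code t) n); rewrite /= ?tnth_mktuple.
by split=> //; rewrite -hy -th tnth_mktuple.
Qed.

Let code_mass n (e : nat -> E) : e 0%N = x ->
  lebesgue_measure
    ([set t | history (code t) n = history e n] `&` `[0%R, 1%R[) = (W n e)%:E.
Proof.
move=> ex; rewrite setIC code_preimage// lebesgue_measure_itv/= lte_fin.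
rewrite ltrDl -EFinD (addrC (L n e)) addrK; case: ltP => // W0.
by congr EFin; apply/eqP; rewrite eq_le W_ge0 W0.
Qed.

Lemma exists_law : exists P, @is_law R E U M x pi P.
Proof.
pose m := mrestr lebesgue_measure (measurable_itv `[0%R, 1%R[ : measurable (_ : set R)).
have m1 : m setT = 1%E.
  by rewrite /m /mrestr/= setTI lebesgue_measure_itv/= lte_fin ltr01 sube0.
pose Q : probability (measurableTypeR R) R := HB.pack m (Measure_isProbability.Build _ _ _ m m1).
pose X : {mfun (measurableTypeR R) >-> canonical_space M} :=
  HB.pack (code : measurableTypeR R -> canonical_space M)
    (isMeasurableFun.Build _ _ _ _ _ measurable_code).
pose P : probability (canonical_space M) R := distribution Q X.
have PE A : P A = lebesgue_measure (code @^-1` A `&` `[0%R, 1%R[) by [].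
exists P; split.
  rewrite PE (_ : code @^-1` _ = setT); first exact: m1.
  by apply/seteqP; split=> // t _ /=; rewrite /code; case: ifP.
move=> n h y; rewrite !PE.
have [hx|hx] := eqVneq (hist_fun h 0%N) x; last first.
  have h0 : [set t | history (code t) n = h] `&` `[0%R, 1%R[ = set0.
    apply/seteqP; split=> // t [/= th]; rewrite in_itv/= => t01.
    move/eqP: hx; apply; have : agree n (code t) (hist_fun h).
      by apply: history_agree; rewrite history_hist_fun.
    by move=> /(_ 0%N (leq0n _)) <-; rewrite /code t01.
  have hC A : A `<=` [set w | history w n = h] ->
      lebesgue_measure (code @^-1` A `&` `[0%R, 1%R[) = 0%E.
    move=> Ah; rewrite (_ : _ `&` _ = set0) ?measure0//.
    by rewrite -subset0 -h0 => t [/Ah].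
  by rewrite [LHS]hC ?[X in _ = (X * _)%E]hC ?mul0e// => w [].
pose e := upd (hist_fun h) n.+1 y.
have ex : e 0%N = x by rewrite /e /upd.
have eh : history e n = h.
  rewrite -[RHS]history_hist_fun; apply: agree_history => i im.
  by rewrite [RHS](upd_agree _ n y _ im).
have en : e n.+1 = y by rewrite /e /upd eqxx.
have -> : code @^-1` [set w | history w n = h /\ w n.+1 = y] =
    [set t | history (code t) n.+1 = history e n.+1].
  apply/seteqP; split=> t /=.
    rewrite -eh => -[/history_agree H wy]; apply: agree_history => i.
    by rewrite leq_eqVlt => /predU1P[->|/H//]; rewrite wy en.
  move=> /history_agree H; split; last by rewrite H.
  by rewrite -eh; apply: agree_history; exact: agreeW H.
rewrite code_mass// (_ : code @^-1` _ = [set t | history (code t) n = history e n]).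
  rewrite code_mass// -EFinM /= /kap eh en; congr (_ * trans _ _ _ _)%:E.
  by rewrite -eh tnth_mktuple.
by rewrite eh.
Qed.

End law_existence.

Definition law (R : realType) (E U : finType) (M : mdp R E U) (x : E)
    (pi : policy E U) : probability (canonical_space M) R :=
  sval (cid (exists_law M x pi)).

Lemma lawP (R : realType) (E U : finType) (M : mdp R E U) (x : E)
  (pi : policy E U) : is_law x pi (law M x pi).
Proof. exact: (svalP (cid (exists_law M x pi))). Qed.

(* The reward series converges when 0 < beta < 1; for other beta the values of
   the definitions below are junk. *)
Definition discounted_reward (R : realType) (E U : finType) (M : mdp R E U)
    (beta : R) (pi : policy E U) (w : nat -> E) : R :=
  limn (series (fun i => beta ^+ i * reward M (w i) (pi i (history w i)))).

Definition J (R : realType) (E U : finType) (M : mdp R E U)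
    (gamma : R) (x : E) (pi : policy E U) (beta : R) : R :=
  let G := discounted_reward M beta pi in
  if gamma == 0 then fine ('E_(law M x pi)[G])%E
  else gamma^-1 * ln (fine ('E_(law M x pi)[fun w => expR (gamma * G w)])%E).

Definition optimal (R : realType) (E U : finType) (M : mdp R E U)
    (beta gamma : R) : set (nat -> E -> U) :=
  [set v | forall x : E, (J M gamma x (markov v) beta)%:E =
     ereal_sup [set (J M gamma x pi beta)%:E | pi in [set: policy E U]]].

Definition gamma_crit (R : realType) (E U : finType) (M : mdp R E U)
    (beta : R) : \bar R :=
  ereal_inf [set r%:E | r in [set r : R | r < 0 /\
    exists u : {ffun E -> U}, forall gamma : R, r <= gamma <= 0 ->
      optimal M beta gamma (stationary u)]].

(* The policy (v, u, u, ...) where v sends x to a and agrees with u elsewhere. *)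
Definition deviation (E U : finType) (x : E) (a : U) (u : {ffun E -> U}) :
    nat -> E -> U :=
  fun n y => if (n == 0)%N && (y == x) then a else u y.

Definition D (R : realType) (E U : finType) (M : mdp R E U)
    (u : {ffun E -> U}) (x : E) (a : U) (beta gamma : R) : R :=
  J M gamma x (markov (stationary u)) beta -
  J M gamma x (markov (deviation x a u)) beta.

Definition rho (R : realType) (E U : finType) (M : mdp R E U)
    (u : {ffun E -> U}) (beta : R) : \bar R :=
  ereal_inf [set r%:E | r in [set r : R | r <= 0 /\
    forall (x : E) (a : U) (gamma : R), r <= gamma <= 0 ->
      0 <= D M u x a beta gamma]].

Definition analytic_at (R : realType) (f : R -> R) (x : R) :=
  exists (a : nat -> R) (r : R), 0 < r /\
    forall y, `|y - x| < r ->
      series (fun n => a n * (y - x) ^+ n) @ \oo --> f y.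

(* Main.v *)
Require Import Defs.
From mathcomp Require Import all_boot all_order all_algebra.
From mathcomp Require Import all_classical all_reals all_analysis.
From mathcomp Require Import measurable_realfun.
From mathcomp Require Import ring lra.
Import Order.TTheory GRing.Theory Num.Theory.
Import numFieldNormedType.Exports.
Local Open Scope classical_set_scope.
Local Open Scope ring_scope.

Set Implicit Arguments.
Unset Strict Implicit.
Unset Printing Implicit Defensive.

(** The theorem describes how the largest interval to the left of 0 on which one
    stationary policy stays optimal depends on the discount factor.

    Instead of [J] one works with the expected utility
    E[(exp (gamma S) - 1) / gamma], where S is the discounted reward. It orders
    policies as [J] does ([J_le_util]), it needs no special case at gamma = 0, and
    it is the sum of a double power series in (beta, gamma), absolutely convergent
    for |beta| < 1 and all gamma, because S is a power series in beta with bounded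
    coefficients ([abs_conv_util], [dsum_util]). Hence the difference of utilities
    between [u] and a one-step deviation, called [gain] below, is jointly
    continuous and analytic, and has the sign of [D].

    By dynamic programming a stationary policy is optimal for all gamma in [r, 0]
    if and only if its gains are nonnegative there ([optimal_iff_never_improved]).
    For gamma < 0 the exponential value of [u] is then a submartingale along any
    policy; the parameters gamma * beta ^ n met on the way stay in [r, 0].

    At (beta0, gamma0) the gain over (x0, a0) has a simple zero with positive
    derivative in gamma. The implicit function theorem gives an analytic branch
    gamma = f beta of zeros, the gain being nonnegative to its right and negative
    to its left ([implicit_branch]). For beta near beta0, compactness makes all
    gains of [u0] nonnegative from the branch up to 0, so the critical parameter is
    at most f beta. Just left of the branch (x0, a0) improves [u0], and every other
    stationary policy is already improved at a parameter strictly above gamma0,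
    because its [rho] is strictly larger; this is stable in beta. So the critical
    parameter equals f beta.

    The analytic implicit function theorem ([implicit_analytic]) is proved without
    complex analysis. A simplified Newton iteration is run on polynomials in
    beta - beta0, the double series being truncated further at each step. It is
    a perturbed contraction for the weighted l1 norm [wnorm] of coefficients,
    and limits of polynomials that are Cauchy for this norm are analytic
    ([analytic_near_poly_lim]). *)

(** * A weighted norm on polynomials, and analytic limits *)

Section WeightedNorm.
Context {R : realType}.
Implicit Types (p q : {poly R}) (rho c : R).

(** The l1 norm of the coefficients with weights [rho ^+ i]. It is
    submultiplicative and dominates the values on the disc of radius [rho], so
    power series computations become norm estimates on polynomials. *)
Definition wnorm rho p : R := \sum_(i < size p) `|p`_i| * rho ^+ i.

Lemma wnorm_wide rho p n : (size p <= n)%N ->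
  wnorm rho p = \sum_(i < n) `|p`_i| * rho ^+ i.
Proof.
move=> pn; rewrite /wnorm (big_ord_widen _ (fun i => `|p`_i| * rho ^+ i) pn).
rewrite big_mkcond; apply: eq_bigr => i _; case: ltnP => // pi.
by rewrite nth_default// normr0 mul0r.
Qed.

Lemma wnorm_ge0 rho p : 0 <= rho -> 0 <= wnorm rho p.
Proof. by move=> r0; apply: sumr_ge0 => i _; rewrite mulr_ge0// exprn_ge0. Qed.

Lemma wnorm_trunc_le rho p n : 0 <= rho ->
  \sum_(i < n) `|p`_i| * rho ^+ i <= wnorm rho p.
Proof.
move=> r0; rewrite (@wnorm_wide _ _ (maxn n (size p)))// ?leq_maxr//.
rewrite (big_ord_widen _ (fun i => `|p`_i| * rho ^+ i) (leq_maxl n (size p))).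
rewrite big_mkcond; apply: ler_sum => i _; case: ifP => // _.
by rewrite mulr_ge0// exprn_ge0.
Qed.

Lemma wnormC rho c : wnorm rho c%:P = `|c|.
Proof.
rewrite (@wnorm_wide _ _ 1) ?size_polyC_leq1//.
by rewrite big_ord1 coefC/= expr0 mulr1.
Qed.

Lemma wnorm0 rho : wnorm rho 0 = 0.
Proof. by rewrite -(polyC0 R) wnormC normr0. Qed.

Lemma wnormD rho p q : 0 <= rho -> wnorm rho (p + q) <= wnorm rho p + wnorm rho q.
Proof.
move=> r0; pose n := maxn (size (p + q)) (maxn (size p) (size q)).
rewrite (@wnorm_wide rho (p + q) n) ?leq_maxl//.
rewrite (@wnorm_wide rho p n) ?leq_max ?leqnn ?orbT//.
rewrite (@wnorm_wide rho q n) ?leq_max ?leqnn ?orbT//.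
rewrite -big_split; apply: ler_sum => i _ /=.
by rewrite coefD -mulrDl ler_wpM2r ?exprn_ge0// ler_normD.
Qed.

Lemma wnormN rho p : wnorm rho (- p) = wnorm rho p.
Proof. by rewrite /wnorm size_polyN; apply: eq_bigr => i _; rewrite coefN normrN. Qed.

Lemma wnormB rho p q : 0 <= rho -> wnorm rho (p - q) <= wnorm rho p + wnorm rho q.
Proof. by move=> r0; rewrite -[in leRHS](wnormN rho q) wnormD. Qed.

Lemma wnormBC rho p q : wnorm rho (p - q) = wnorm rho (q - p).
Proof. by rewrite -wnormN opprB. Qed.

Lemma wnorm_sum rho (I : Type) (s : seq I) (P : pred I) (F : I -> {poly R}) :
  0 <= rho ->
  wnorm rho (\sum_(i <- s | P i) F i) <= \sum_(i <- s | P i) wnorm rho (F i).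
Proof.
move=> r0; elim/big_rec2: _ => [|i y p _ H]; first by rewrite wnorm0.
by apply: le_trans (wnormD _ _ r0) _; rewrite lerD2l.
Qed.

Lemma wnormZ rho c p : wnorm rho (c *: p) = `|c| * wnorm rho p.
Proof.
rewrite (@wnorm_wide _ _ (size p)) ?size_scale_leq// mulr_sumr.
by apply: eq_bigr => i _; rewrite coefZ normrM mulrA.
Qed.

Lemma wnorm_cons rho p c : wnorm rho (p * 'X + c%:P) = wnorm rho p * rho + `|c|.
Proof.
rewrite (@wnorm_wide _ _ (size p).+1); last first.
  by rewrite size_MXaddC; case: ifP.
rewrite big_ord_recl coefD coefMX coefC/= add0r expr0 mulr1 addrC; congr (_ + _).
rewrite mulr_suml; apply: eq_bigr => i _.
by rewrite coefD coefMX coefC/= addr0 exprSr mulrA.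
Qed.

(** Induction on the degree of [p], through Horner's form of the product. *)
Lemma wnormM rho p q : 0 <= rho -> wnorm rho (p * q) <= wnorm rho p * wnorm rho q.
Proof.
move=> r0; elim/poly_ind: p => [|p c IH]; first by rewrite mul0r wnorm0 mul0r.
have -> : (p * 'X + c%:P) * q = (p * q) * 'X + 0%:P + c *: q.
  by rewrite polyC0 addr0 mulrDl mul_polyC mulrAC.
apply: le_trans (wnormD _ _ r0) _; rewrite wnormZ !wnorm_cons normr0 addr0 mulrDl.
by rewrite lerD2r mulrAC ler_wpM2r.
Qed.

Lemma wnormXn rho p n : 0 <= rho -> wnorm rho (p ^+ n) <= wnorm rho p ^+ n.
Proof.
move=> r0; elim: n => [|n IH]; first by rewrite !expr0 -(polyC1 R) wnormC normr1.
rewrite !exprS; apply: le_trans (wnormM _ _ r0) _.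
by rewrite ler_wpM2l ?wnorm_ge0.
Qed.

Lemma wnormX rho : 0 <= rho -> wnorm rho 'X = rho.
Proof.
by move=> r0; rewrite -['X]mul1r -[_ * _]addr0 -(polyC0 R) wnorm_cons
  -(polyC1 R) wnormC normr1 normr0 addr0 mul1r.
Qed.

Lemma wnorm_coef rho p i : 0 <= rho -> `|p`_i| * rho ^+ i <= wnorm rho p.
Proof.
move=> r0; apply: le_trans (wnorm_trunc_le p i.+1 r0).
rewrite big_ord_recr/= lerDr; apply: sumr_ge0 => j _.
by rewrite mulr_ge0 ?exprn_ge0.
Qed.

Lemma trunc_horner_le rho p t n : `|t| <= rho ->
  `|\sum_(i < n) p`_i * t ^+ i| <= wnorm rho p.
Proof.
move=> tr; have r0 := le_trans (normr_ge0 t) tr.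
apply: le_trans (wnorm_trunc_le p n r0); apply: le_trans (ler_norm_sum _ _ _) _.
apply: ler_sum => i _; rewrite normrM normrX ler_wpM2l//.
by rewrite lerXn2r ?nnegrE.
Qed.

Lemma horner_le_wnorm rho p t : `|t| <= rho -> `|p.[t]| <= wnorm rho p.
Proof. by move=> tr; rewrite horner_coef; exact: trunc_horner_le. Qed.

(** Moving the centre of a polynomial by [c] costs [`|c|] in the radius, which is
    why limits of polynomials are analytic at every point near the centre. *)
Lemma wnorm_shift rho sigma p c : 0 <= sigma -> `|c| + sigma <= rho ->
  wnorm sigma (p \Po ('X + c%:P)) <= wnorm rho p.
Proof.
move=> s0 cs; rewrite comp_polyE; apply: le_trans (wnorm_sum _ _ _ s0) _.
apply: ler_sum => i _; rewrite wnormZ ler_wpM2l//.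
apply: le_trans (wnormXn _ _ s0) _; rewrite lerXn2r ?nnegrE ?wnorm_ge0//.
  by rewrite (le_trans _ cs)// addr_ge0.
by apply: le_trans cs; rewrite addrC -[in leRHS](wnormX s0) -(wnormC sigma c) wnormD.
Qed.

End WeightedNorm.

Section LimitsOfPolynomials.
Context {R : realType}.

(** The remainder [T] is carried along because it bounds the distance to the
    limit as well. *)
Lemma cauchy_rate (u T : nat -> R) :
  (forall m n, (m <= n)%N -> `|u n - u m| <= T m) -> T @ \oo --> 0 ->
  cvgn u /\ forall m, `|limn u - u m| <= T m.
Proof.
move=> uT T0; have uc : cvgn u.
  apply/cauchy_cvgP/cauchy_exP => e e0.
  have [N _ /(_ N (leqnn _)) TN] := (cvgr0Pnorm_lt T).1 T0 _ e0.
  exists (u N); exists N => // n /= Nn; rewrite -ball_normE /ball_/= distrC.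
  apply: le_lt_trans (uT _ _ Nn) _; apply: le_lt_trans TN; exact: ler_norm.
split=> // m.
have H : (fun n => `|u n - u m|) @ \oo --> `|limn u - u m|.
  by apply: cvg_norm; apply: cvgB => //; exact: cvg_cst.
rewrite -(cvg_lim _ H)//; apply: limr_le; first by apply/cvg_ex; eexists; exact: H.
by near=> n; apply: uT; near: n; exists m.
Unshelve. all: by end_near.
Qed.

(** Coefficientwise limits exist, and the remainder [T m] bounds all partial
    sums of the limit series against those of [p m] at once. *)
Lemma analytic_at_poly_lim (p : nat -> {poly R}) (T : nat -> R) (rho x : R)
    (f : R -> R) : 0 < rho ->
  (forall m n, (m <= n)%N -> wnorm rho (p n - p m) <= T m) -> T @ \oo --> 0 ->
  (forall y, `|y - x| < rho -> (p n).[y - x] @[n --> \oo] --> f y) ->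
  analytic_at f x.
Proof.
move=> r0 pT T0 pf.
have pc i : cvgn (fun n => (p n)`_i).
  apply: (proj1 (cauchy_rate (T := fun m => T m / rho ^+ i) _ _)) => [m n mn|].
    rewrite ler_pdivlMr ?exprn_gt0// -coefB.
    by apply: le_trans (pT _ _ mn); apply: wnorm_coef; exact: ltW.
  by rewrite -(mul0r (rho ^+ i)^-1); apply: cvgM => //; exact: cvg_cst.
pose a i := limn (fun n => (p n)`_i).
exists a, rho; split=> // y yx.
pose t := y - x; have tr : `|t| <= rho by exact: ltW.
have aT m N : `|\sum_(i < N) a i * t ^+ i - \sum_(i < N) (p m)`_i * t ^+ i| <= T m.
  have H : (fun n => `|\sum_(i < N) (p n)`_i * t ^+ i - \sum_(i < N) (p m)`_i * t ^+ i|)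
      @ \oo --> `|\sum_(i < N) a i * t ^+ i - \sum_(i < N) (p m)`_i * t ^+ i|.
    apply: cvg_norm; apply: cvgB; last exact: cvg_cst.
    apply: cvg_big => [|i _]; first exact: add_continuous.
    by apply: cvgM; [exact: pc|exact: cvg_cst].
  rewrite -(cvg_lim _ H)//; apply: limr_le; first by apply/cvg_ex; eexists; exact: H.
  near=> n; rewrite -sumrB; under eq_bigr do rewrite -mulrBl -coefB.
  apply: le_trans (trunc_horner_le _ _ tr) _; apply: pT; near: n; by exists m.
apply/cvgrPdist_lt => e e0.
have e3 : 0 < e / 3 by rewrite divr_gt0.
have [m [Tm pm]] : exists m, T m < e / 3 /\ `|f y - (p m).[t]| < e / 3.
  have : \forall m \near \oo, T m < e / 3 /\ `|f y - (p m).[t]| < e / 3.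
    near=> m; split; last by near: m; exact: cvgr_dist_lt (pf _ yx) _ e3.
    apply: le_lt_trans (ler_norm _) _; near: m; exact: (cvgr0Pnorm_lt T).1 T0 _ e3.
  by case=> m _ /(_ m (leqnn _)) H; exists m.
near=> N; rewrite /series/= big_mkord.
have pN : (p m).[t] = \sum_(i < N) (p m)`_i * t ^+ i.
  by apply: horner_coef_wide; near: N; exists (size (p m)).
have := aT m N; rewrite -pN distrC => aN.
have -> : f y - \sum_(i < N) a i * t ^+ i =
   (f y - (p m).[t]) + ((p m).[t] - \sum_(i < N) a i * t ^+ i) by ring.
apply: le_lt_trans (ler_normD _ _) _; lra.
Unshelve. all: by end_near.
Qed.

(** The recentred polynomials converge in the norm of the smaller radius, so no
    rearrangement of the limit series is needed. *)
Lemma analytic_near_poly_lim (p : nat -> {poly R}) (T : nat -> R) (rho x : R)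
    (f : R -> R) : 0 < rho ->
  (forall m n, (m <= n)%N -> wnorm rho (p n - p m) <= T m) -> T @ \oo --> 0 ->
  (forall y, `|y - x| < rho -> (p n).[y - x] @[n --> \oo] --> f y) ->
  forall z, `|z - x| < rho -> analytic_at f z.
Proof.
move=> r0 pT T0 pf z zx; have s0 : 0 < rho - `|z - x| by rewrite subr_gt0.
apply: (@analytic_at_poly_lim (fun n => p n \Po ('X + (z - x)%:P)) T _ _ _ s0) => //.
  move=> m n mn; rewrite -comp_polyB; apply: le_trans (pT _ _ mn).
  by apply: wnorm_shift; rewrite ?(ltW s0)// addrC subrK.
move=> y yz; have yx : `|y - x| < rho.
  have -> : y - x = (y - z) + (z - x) by ring.
  by apply: le_lt_trans (ler_normD _ _) _; rewrite -ltrBrDr.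
suff -> : (fun n => (p n \Po ('X + (z - x)%:P)).[y - z]) = (fun n => (p n).[y - x]).
  exact: pf.
apply/funext => n; by rewrite horner_comp hornerD hornerX hornerC addrA subrK.
Qed.

End LimitsOfPolynomials.

(** * Double power series *)

Section DoubleSeries.
Context {R : realType}.
Implicit Types (a : nat -> nat -> R) (b g beta gamma rho th : R) (B G P : {poly R}).

Definition sqsum (V : nmodType) N (f : nat -> nat -> V) : V :=
  \sum_(j < N) \sum_(k < N) f j k.

Lemma sqsumS (V : nmodType) N (f : nat -> nat -> V) :
  sqsum N.+1 f = sqsum N f + (\sum_(j < N) f j N + \sum_(k < N.+1) f N k).
Proof.
rewrite /sqsum big_ord_recr/= addrA; congr (_ + _).
by rewrite -big_split/=; apply: eq_bigr => j _; rewrite big_ord_recr.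
Qed.

Lemma sqsumB (V : zmodType) N (f h : nat -> nat -> V) :
  sqsum N f - sqsum N h = sqsum N (fun j k => f j k - h j k).
Proof. by rewrite /sqsum -sumrB; apply: eq_bigr => j _; rewrite sumrB. Qed.

Lemma mulr_sqsuml N (f : nat -> nat -> R) c :
  sqsum N f * c = sqsum N (fun j k => f j k * c).
Proof. by rewrite /sqsum mulr_suml; apply: eq_bigr => j _; rewrite mulr_suml. Qed.

Lemma wnorm_sqsum rho N (f : nat -> nat -> {poly R}) (F : nat -> nat -> R) :
  0 <= rho -> (forall j k, wnorm rho (f j k) <= F j k) ->
  wnorm rho (sqsum N f) <= sqsum N F.
Proof.
move=> r0 fF; apply: le_trans (wnorm_sum _ _ _ r0) _; apply: ler_sum => j _.
by apply: le_trans (wnorm_sum _ _ _ r0) _; apply: ler_sum.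
Qed.

(** Two square truncations of a double series differ by no more than the same
    truncations of a majorant. *)
Lemma wnorm_sqsumB rho m n (f : nat -> nat -> {poly R}) (F : nat -> nat -> R) :
  0 <= rho -> (forall j k, wnorm rho (f j k) <= F j k) -> (m <= n)%N ->
  wnorm rho (sqsum n f - sqsum m f) <= sqsum n F - sqsum m F.
Proof.
move=> r0 fF; elim: n => [|n IH]; first by rewrite leqn0 => /eqP ->; rewrite !subrr wnorm0.
rewrite leq_eqVlt => /predU1P[->|]; first by rewrite !subrr wnorm0.
rewrite ltnS => /IH {}IH; rewrite !sqsumS addrAC [leRHS]addrAC.
apply: le_trans (wnormD _ _ r0) _; apply: lerD IH _.
apply: le_trans (wnormD _ _ r0) _; apply: lerD;
  by apply: le_trans (wnorm_sum _ _ _ r0) _; apply: ler_sum.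
Qed.

Definition dps a N beta gamma : R :=
  sqsum N (fun j k => a j k * beta ^+ j * gamma ^+ k).

Definition dps_poly a N B G : {poly R} :=
  sqsum N (fun j k => (a j k)%:P * B ^+ j * G ^+ k).

Definition dps_abs a N beta gamma : R := dps (fun j k => `|a j k|) N beta gamma.

(** Convergence on the domain |beta| < 1, gamma arbitrary, on which the
    exponential utility of a discounted reward is analytic. *)
Definition abs_conv a := forall b g, 0 <= b < 1 -> 0 <= g ->
  exists K, forall N, dps_abs a N b g <= K.

Definition dsum a beta gamma : R := limn (fun N => dps a N beta gamma).

Lemma dps_horner a N B G t : (dps_poly a N B G).[t] = dps a N B.[t] G.[t].
Proof.
rewrite /dps_poly /dps /sqsum horner_sum; apply: eq_bigr => j _.
rewrite horner_sum; apply: eq_bigr => k _.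
by rewrite !hornerM hornerC !horner_exp.
Qed.

Lemma dps_polyC a N beta gamma : dps_poly a N beta%:P gamma%:P = (dps a N beta gamma)%:P.
Proof.
rewrite /dps_poly /dps /sqsum rmorph_sum; apply: eq_bigr => j _.
by rewrite rmorph_sum; apply: eq_bigr => k _; rewrite -!polyC_exp -!polyCM.
Qed.

Lemma wnorm_monom a rho B G b g j k : 0 <= rho ->
  wnorm rho B <= b -> wnorm rho G <= g ->
  wnorm rho ((a j k)%:P * B ^+ j * G ^+ k) <= `|a j k| * b ^+ j * g ^+ k.
Proof.
move=> r0 Bb Gg; have w0 := fun p => wnorm_ge0 p r0.
have X p c n : wnorm rho p <= c -> wnorm rho (p ^+ n) <= c ^+ n.
  move=> pc; apply: le_trans (wnormXn _ _ r0) _.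
  by rewrite lerXn2r ?nnegrE// (le_trans _ pc).
apply: le_trans (wnormM _ _ r0) _; apply: ler_pM => //; last exact: X.
apply: le_trans (wnormM _ _ r0) _; rewrite wnormC ler_wpM2l//; exact: X.
Qed.

Lemma wnorm_dps_tail a rho B G b g m n : 0 <= rho ->
  wnorm rho B <= b -> wnorm rho G <= g -> (m <= n)%N ->
  wnorm rho (dps_poly a n B G - dps_poly a m B G) <=
    dps_abs a n b g - dps_abs a m b g.
Proof. by move=> r0 Bb Gg; apply: wnorm_sqsumB => // j k; exact: wnorm_monom. Qed.

Lemma dps_abs_mono a b g m n : 0 <= b -> 0 <= g -> (m <= n)%N ->
  dps_abs a m b g <= dps_abs a n b g.
Proof.
move=> b0 g0 mn; rewrite -subr_ge0.
apply: le_trans (wnorm_dps_tail (rho := 0) (B := b%:P) (G := g%:P) _ _ _ _ mn);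
  by rewrite ?wnorm_ge0// wnormC ger0_norm.
Qed.

Lemma monotone_tail (S : nat -> R) K :
  (forall m n, (m <= n)%N -> S m <= S n) -> (forall n, S n <= K) ->
  exists2 T : nat -> R, T @ \oo --> 0 &
    forall m n, (m <= n)%N -> S n - S m <= T m.
Proof.
move=> Sm SK; have Sc : cvgn S.
  by apply: nondecreasing_is_cvgn => //; exists K => _ [n _ <-].
exists (fun m => limn S - S m).
  by rewrite -(subrr (limn S)); apply: cvgB => //; exact: cvg_cst.
by move=> m n mn; rewrite lerD2r; apply: nondecreasing_cvgn_le.
Qed.

(** Uniformity of the truncation error on a polydisc yields joint continuity of
    the sum. *)
Lemma dps_unif a b g : abs_conv a -> 0 <= b < 1 -> 0 <= g ->
  exists2 T : nat -> R, T @ \oo --> 0 & forall beta gamma,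
    `|beta| <= b -> `|gamma| <= g ->
    dps a N beta gamma @[N --> \oo] --> dsum a beta gamma /\
    forall m, `|dsum a beta gamma - dps a m beta gamma| <= T m.
Proof.
move=> ac b1 g0; have /andP[b0 _] := b1; have [K aK] := ac b g b1 g0.
have [T T0 ST] := monotone_tail (fun m n => dps_abs_mono a b0 g0) aK.
exists T => // beta gamma bb gg.
apply: (@cauchy_rate _ (fun N => dps a N beta gamma) T) => // m n mn.
apply: le_trans (ST _ _ mn).
rewrite -(wnormC 0) polyCB -!dps_polyC.
by apply: wnorm_dps_tail => //; rewrite wnormC.
Qed.

Lemma dsum_cvg a beta gamma : abs_conv a -> `|beta| < 1 ->
  dps a N beta gamma @[N --> \oo] --> dsum a beta gamma.
Proof.
move=> ac b1; have [|T _ H] := @dps_unif a `|beta| `|gamma| ac _ (normr_ge0 _).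
  by rewrite normr_ge0.
by have [] := H beta gamma (lexx _) (lexx _).
Qed.

Lemma dps_continuous a N (z : R * R) :
  (fun z : R * R => dps a N z.1 z.2) @ z --> dps a N z.1 z.2.
Proof.
have X (h : R * R -> R) n : h @ z --> h z -> (fun z => h z ^+ n) @ z --> h z ^+ n.
  move=> hz; elim: n => [|n IH]; first by rewrite expr0; exact: cvg_cst.
  rewrite exprS (_ : (fun z => _) = (fun z => h z * h z ^+ n)); last first.
    by apply/funext => y; rewrite exprS.
  exact: cvgM.
apply: cvg_big => [|j _]; first exact: add_continuous.
apply: cvg_big => [|k _]; first exact: add_continuous.
apply: cvgM; last by apply: X; exact: cvg_snd.
by apply: cvgM; [exact: cvg_cst|apply: X; exact: cvg_fst].
Qed.

Lemma dsum_continuous a (z : R * R) : abs_conv a -> `|z.1| < 1 ->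
  (fun z : R * R => dsum a z.1 z.2) @ z --> dsum a z.1 z.2.
Proof.
move=> ac z1; pose b := (`|z.1| + 1) / 2; pose g := `|z.2| + 1.
have n0 := normr_ge0 z.1; have n2 := normr_ge0 z.2.
have b1 : 0 <= b < 1 by rewrite /b; apply/andP; split; lra.
have g0 : 0 <= g by rewrite /g; lra.
have [T T0 H] := dps_unif ac b1 g0.
apply/cvgrPdist_lt => e e0; have e3 : 0 < e / 3 by rewrite divr_gt0.
have [m _ /(_ m (leqnn _)) Tm] := (cvgr0Pnorm_lt T).1 T0 _ e3.
have {}Tm := le_lt_trans (ler_norm _) Tm.
have zb : `|z.1| <= b by rewrite /b; lra.
have zg : `|z.2| <= g by rewrite /g; lra.
near=> y.
have yb : `|y.1| <= b.
  near: y; apply: (@cvgr_norm_le _ _ _ _ _ (fun y : R * R => y.1) z.1 _ b).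
    exact: cvg_fst.
  by rewrite /b; lra.
have yg : `|y.2| <= g.
  near: y; apply: (@cvgr_norm_le _ _ _ _ _ (fun y : R * R => y.2) z.2 _ g).
    exact: cvg_snd.
  by rewrite /g; lra.
have [_ /(_ m) Hz] := H _ _ zb zg; have [_ /(_ m) Hy] := H _ _ yb yg.
have yz : `|dps a m z.1 z.2 - dps a m y.1 y.2| < e / 3.
  by near: y; apply: cvgr_dist_lt e3; exact: dps_continuous.
have -> : dsum a z.1 z.2 - dsum a y.1 y.2 =
  (dsum a z.1 z.2 - dps a m z.1 z.2) + (dps a m z.1 z.2 - dps a m y.1 y.2)
   - (dsum a y.1 y.2 - dps a m y.1 y.2) by ring.
apply: le_lt_trans (ler_normB _ _) _.
have := ler_normD (dsum a z.1 z.2 - dps a m z.1 z.2) (dps a m z.1 z.2 - dps a m y.1 y.2).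
lra.
Unshelve. all: by end_near.
Qed.

Lemma abs_convB a a' : abs_conv a -> abs_conv a' ->
  abs_conv (fun j k => a j k - a' j k).
Proof.
move=> ac ac' b g b1 g0; have [K aK] := ac b g b1 g0; have [K' aK'] := ac' b g b1 g0.
exists (K + K') => N; apply: le_trans (lerD (aK N) (aK' N)).
rewrite /dps_abs /dps /sqsum -big_split/=; apply: ler_sum => j _.
rewrite -big_split/=; apply: ler_sum => k _; have /andP[b0 _] := b1.
by rewrite -!mulrDl !ler_wpM2r ?exprn_ge0// ler_normB.
Qed.

Lemma dsumB a a' beta gamma : abs_conv a -> abs_conv a' -> `|beta| < 1 ->
  dsum (fun j k => a j k - a' j k) beta gamma = dsum a beta gamma - dsum a' beta gamma.
Proof.
move=> ac ac' b1; apply: cvg_lim => //.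
rewrite (_ : (fun N => _) = (fun N => dps a N beta gamma - dps a' N beta gamma)).
  by apply: cvgB; exact: dsum_cvg.
by apply/funext => N; rewrite /dps sqsumB /sqsum; do 2!apply: eq_bigr => ? _; rewrite -!mulrBl.
Qed.

End DoubleSeries.

(** * Increments of a double power series in its second variable *)

Section Increments.
Context {R : realType}.
Implicit Types (a : nat -> nat -> R) (b c g beta gamma rho th : R) (B P : {poly R}).

(** The error is measured against the slack [b - `|c|] between a constant and its
    majorant because this form is stable under products with the same [th]. *)
Definition near_const rho th P c b :=
  [/\ `|c| <= b, wnorm rho P <= b & wnorm rho (P - c%:P) <= th * (b - `|c|)].

Lemma near_constM rho th P P' c c' b b' : 0 <= rho -> 0 <= th ->
  near_const rho th P c b -> near_const rho th P' c' b' ->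
  near_const rho th (P * P') (c * c') (b * b').
Proof.
move=> r0 th0 [cb Pb Pc] [cb' Pb' Pc'].
have w0 := fun p : {poly R} => wnorm_ge0 p r0; have c0 := normr_ge0.
split; first by rewrite normrM ler_pM.
  by apply: le_trans (wnormM _ _ r0) _; exact: ler_pM.
rewrite (_ : _ - _ = P * (P' - c'%:P) + (P - c%:P) * c'%:P); last first.
  by rewrite polyCM; ring.
apply: le_trans (wnormD _ _ r0) _.
have H1 := wnormM P (P' - c'%:P) r0; have H2 := wnormM (P - c%:P) c'%:P r0.
apply: le_trans (lerD H1 H2) _; rewrite wnormC.
have -> : th * (b * b' - `|c * c'|) = b * (th * (b' - `|c'|)) + th * (b - `|c|) * `|c'|.
  by rewrite normrM; ring.
by apply: lerD; [apply: ler_pM|apply: ler_wpM2r].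
Qed.

Lemma near_constXn rho th P c b n : 0 <= rho -> 0 <= th ->
  near_const rho th P c b -> near_const rho th (P ^+ n) (c ^+ n) (b ^+ n).
Proof.
move=> r0 th0 H; elim: n => [|n IH]; last by rewrite !exprS; exact: near_constM.
rewrite !expr0; split; first by rewrite normr1.
  by rewrite -(polyC1 R) wnormC normr1.
by rewrite polyC1 !subrr wnorm0 normr1 subrr mulr0.
Qed.

(** Adding [1] to the radius absorbs the factor [k] of a derivative. *)
Lemma deriv_exp_le (g : R) k : 0 <= g -> k%:R * g ^+ k.-1 <= (g + 1) ^+ k.
Proof.
move=> g0; elim: k => [|[|k] IH]; first by rewrite mul0r expr0.
  by rewrite !expr1 /= expr0 mulr1 lerDr.
have H : k.+1%:R * g ^+ k.+1 = g * (k.+1%:R * g ^+ k) by rewrite exprS; ring.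
have H' : g ^+ k.+1 <= (g + 1) ^+ k.+1.
  by rewrite lerXn2r ?nnegrE ?lerDl ?addr_ge0.
rewrite -natr1 mulrDl mul1r /= [leRHS]exprS mulrDl mul1r H lerD//.
by rewrite ler_wpM2l.
Qed.

Definition dps_deriv a beta gamma N : R :=
  sqsum N (fun j k => a j k * beta ^+ j * (k%:R * gamma ^+ k.-1)).

Definition dsum_deriv a beta gamma : R := limn (dps_deriv a beta gamma).

Lemma dps_deriv_cvg a beta gamma : abs_conv a -> `|beta| < 1 ->
  dps_deriv a beta gamma @ \oo --> dsum_deriv a beta gamma.
Proof.
move=> ac b1; have g0 : 0 <= `|gamma| + 1 by rewrite addr_ge0.
have b01 : 0 <= `|beta| < 1 by rewrite normr_ge0.
have [K aK] := ac _ _ b01 g0.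
have [T T0 ST] := monotone_tail (fun m n => dps_abs_mono a (normr_ge0 beta) g0) aK.
apply: (proj1 (@cauchy_rate _ (dps_deriv a beta gamma) T _ T0)) => m n mn.
apply: le_trans (ST _ _ mn).
rewrite -(wnormC 0) polyCB (_ : (dps_deriv _ _ _ n)%:P = sqsum n (fun j k =>
    (a j k * beta ^+ j * (k%:R * gamma ^+ k.-1))%:P)); last first.
  by rewrite /dps_deriv /sqsum rmorph_sum; apply: eq_bigr => j _; rewrite rmorph_sum.
rewrite (_ : (dps_deriv _ _ _ m)%:P = sqsum m (fun j k =>
    (a j k * beta ^+ j * (k%:R * gamma ^+ k.-1))%:P)); last first.
  by rewrite /dps_deriv /sqsum rmorph_sum; apply: eq_bigr => j _; rewrite rmorph_sum.
apply: wnorm_sqsumB => // j k; rewrite wnormC !normrM !normrX.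
by rewrite ler_wpM2l ?mulr_ge0 ?exprn_ge0// ger0_norm// deriv_exp_le.
Qed.

(** Each monomial is differentiated discretely: the quotient of the difference
    of its values by [P1 - P2] is a sum of products of elements close to
    constants, so it is close to the derivative of the monomial. *)
Lemma wnorm_dps_increment a N rho th B P1 P2 beta gamma b g :
  0 <= rho -> 0 <= th -> near_const rho th B beta b ->
  near_const rho th P1 gamma g -> near_const rho th P2 gamma g ->
  wnorm rho (dps_poly a N B P1 - dps_poly a N B P2
             - (dps_deriv a beta gamma N)%:P * (P1 - P2)) <=
    th * dps_abs a N b (g + 1) * wnorm rho (P1 - P2).
Proof.
move=> r0 th0 HB H1 H2; have [cb _ _] := HB; have [cg _ _] := H1.
have b0 := le_trans (normr_ge0 _) cb; have g0 := le_trans (normr_ge0 _) cg.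
rewrite sqsumB (_ : (dps_deriv _ _ _ _)%:P * _ = sqsum N (fun j k =>
    (a j k * beta ^+ j * (k%:R * gamma ^+ k.-1))%:P * (P1 - P2))); last first.
  rewrite /dps_deriv /sqsum rmorph_sum mulr_suml; apply: eq_bigr => j _.
  by rewrite rmorph_sum mulr_suml.
rewrite sqsumB (mulrC th) -mulrA mulr_sqsuml; apply: wnorm_sqsum => // j k.
rewrite (_ : _ - _ = (a j k)%:P * ((P1 - P2) * \sum_(i < k)
    (B ^+ j * (P1 ^+ (k.-1 - i) * P2 ^+ i) - (beta ^+ j * gamma ^+ k.-1)%:P))); last first.
  rewrite -mulrBr subrXX sumrB sumr_const card_ord -mulr_sumr.
  rewrite -mulr_natr !polyCM polyC_natr; ring.
apply: le_trans (wnormM _ _ r0) _; rewrite wnormC -!mulrA ler_wpM2l//.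
apply: le_trans (wnormM _ _ r0) _.
rewrite [leRHS](_ : _ = wnorm rho (P1 - P2) * (th * (b ^+ j * (g + 1) ^+ k))); last ring.
rewrite ler_wpM2l ?wnorm_ge0//.
apply: le_trans (wnorm_sum _ _ _ r0) _.
apply: (@le_trans _ _ (\sum_(i < k) th * (b ^+ j * g ^+ k.-1))).
  apply: ler_sum => i _.
  have [] := near_constM r0 th0 (near_constXn j r0 th0 HB)
    (near_constM r0 th0 (near_constXn (k.-1 - i) r0 th0 H1) (near_constXn i r0 th0 H2)).
  have ik : (i <= k.-1)%N by case: k i => [[]//|k] i; rewrite -ltnS.
  rewrite -!exprD subnK// => _ _ /le_trans; apply.
  by rewrite ler_wpM2l// gerBl.
rewrite sumr_const card_ord -mulrnAr ler_wpM2l// -mulrnAr ler_wpM2l ?exprn_ge0//.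
by rewrite -mulr_natl deriv_exp_le.
Qed.

Lemma wnorm_dps_near a N rho th B P beta gamma b g :
  0 <= rho -> 0 <= th -> near_const rho th B beta b -> near_const rho th P gamma g ->
  wnorm rho (dps_poly a N B P - (dps a N beta gamma)%:P) <= th * dps_abs a N b g.
Proof.
move=> r0 th0 HB HP; rewrite -dps_polyC sqsumB mulrC mulr_sqsuml.
apply: wnorm_sqsum => // j k.
rewrite -!mulrA -mulrBr; apply: le_trans (wnormM _ _ r0) _.
rewrite wnormC ler_wpM2l// -!polyC_exp -polyCM.
have [H _] := near_constM r0 th0 (near_constXn j r0 th0 HB) (near_constXn k r0 th0 HP).
by move=> /le_trans; apply; rewrite mulrA [leRHS]mulrC ler_wpM2l// gerBl.
Qed.

(** One radius suffices for the remainder to be [th * K] times the increment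
    on the box scaled by [th]: this is both differentiability in [gamma] and,
    for small [th], monotonicity. *)
Lemma dsum_increment a beta0 gamma0 : abs_conv a -> 0 <= beta0 < 1 ->
  exists2 K : R, 0 <= K & forall th beta gamma gamma', 0 <= th <= 1 ->
   `|beta - beta0| <= th * ((1 - beta0) / 2) ->
   `|gamma - gamma0| <= th -> `|gamma' - gamma0| <= th ->
   `|dsum a beta gamma' - dsum a beta gamma
     - dsum_deriv a beta0 gamma0 * (gamma' - gamma)| <= th * K * `|gamma' - gamma|.
Proof.
move=> ac /andP[b00 b01].
pose b := (1 + beta0) / 2; pose g := `|gamma0| + 1.
have b1 : 0 <= b < 1 by rewrite /b; apply/andP; split; lra.
have g0 : 0 <= g + 1 by rewrite /g !addr_ge0.
have [K aK] := ac _ _ b1 g0.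
exists K; first by apply: le_trans (aK 0%N); rewrite /dps_abs /dps /sqsum big_ord0.
move=> th beta gamma gamma' /andP[th0 th1] hb hg hg'.
have nb : near_const 0 th beta%:P beta0 b.
  have eb : b - `|beta0| = (1 - beta0) / 2 by rewrite /b ger0_norm//; lra.
  split; first by rewrite -subr_ge0 eb; lra.
    rewrite wnormC -(subrK beta0 beta); apply: le_trans (ler_normD _ _) _.
    rewrite -lerBrDr eb; apply: le_trans hb _; rewrite ler_piMl//; lra.
  by rewrite -polyCB wnormC eb.
have ng x : `|x - gamma0| <= th -> near_const 0 th x%:P gamma0 g.
  move=> xg; split; first by rewrite /g lerDl.
    rewrite wnormC -(subrK gamma0 x); apply: le_trans (ler_normD _ _) _.
    by rewrite /g addrC lerD2l (le_trans xg).
  by rewrite -polyCB wnormC /g addrAC subrr add0r mulr1.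
have bb : `|beta| < 1.
  by have [_ + _] := nb; rewrite wnormC; case/andP: b1 => _ /[swap]; exact: le_lt_trans.
have b0n : `|beta0| < 1 by rewrite ger0_norm.
have lim : (fun N => `|dps a N beta gamma' - dps a N beta gamma
     - dps_deriv a beta0 gamma0 N * (gamma' - gamma)|) @ \oo -->
   `|dsum a beta gamma' - dsum a beta gamma
     - dsum_deriv a beta0 gamma0 * (gamma' - gamma)|.
  apply: cvg_norm; apply: cvgB; first by apply: cvgB; exact: dsum_cvg.
  by apply: cvgM; [exact: dps_deriv_cvg|exact: cvg_cst].
rewrite -(cvg_lim _ lim)//; apply: limr_le; first by apply/cvg_ex; eexists; exact: lim.
apply: nearW => N.
have := @wnorm_dps_increment a N 0 th _ _ _ _ _ _ _ (lexx 0) th0 nb (ng _ hg') (ng _ hg).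
rewrite !dps_polyC -!polyCB -polyCM -polyCB !wnormC => /le_trans; apply.
by rewrite ler_wpM2r// ler_wpM2l.
Qed.

End Increments.

(** * The analytic implicit function theorem *)

Section ImplicitFunction.
Context {R : realType}.
Implicit Types (p : {poly R}).

(** A perturbed contraction: the potential [2 d - 2 S], with [d] the length of
    the last step and [S] the accumulated perturbation, decreases by at least
    one step length at a time. *)
Lemma perturbed_contraction (rho : R) (G : nat -> {poly R}) (S : nat -> R) K :
  0 <= rho -> (forall m, S m <= K) ->
  (forall m, wnorm rho (G m.+2 - G m.+1) <=
     wnorm rho (G m.+1 - G m) / 2 + (S m.+1 - S m)) ->
  exists2 T : nat -> R, T @ \oo --> 0 &
    forall m n, (m <= n)%N -> wnorm rho (G n - G m) <= T m.
Proof.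
move=> r0 SK GS; pose d m := wnorm rho (G m.+1 - G m).
have d0 m : 0 <= d m by exact: wnorm_ge0.
pose W m := 2 * S m - 2 * d m.
have Wd m : d m <= W m.+1 - W m by have := GS m; rewrite /W -/(d m) -/(d m.+1); lra.
have dW m n : (m <= n)%N -> wnorm rho (G n - G m) <= W n - W m.
  elim: n => [|n IH]; first by rewrite leqn0 => /eqP ->; rewrite !subrr wnorm0.
  rewrite leq_eqVlt => /predU1P[->|]; first by rewrite !subrr wnorm0.
  rewrite ltnS => /IH {}IH; rewrite -[G n.+1 in leLHS](subrK (G n)) -addrA.
  by apply: le_trans (wnormD _ _ r0) _; apply: le_trans (lerD (Wd n) IH) _; lra.
have [T T0 WT] := @monotone_tail _ W (2 * K) (fun m n mn =>
   etrans (esym (subr_ge0 _ _)) (le_trans (wnorm_ge0 _ r0) (dW m n mn))) (fun n =>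
   ltac:(rewrite /W; have := SK n; have := d0 n; lra)).
by exists T => // m n mn; apply: le_trans (dW m n mn) (WT m n mn).
Qed.

(** Simplified Newton iteration with polynomials in [beta - beta0], the double
    series being truncated further at every step. *)
Lemma implicit_analytic (a : nat -> nat -> R) (beta0 gamma0 : R) :
  abs_conv a -> 0 <= beta0 < 1 -> dsum a beta0 gamma0 = 0 ->
  dsum_deriv a beta0 gamma0 != 0 ->
  forall delta0, 0 < delta0 ->
  exists2 rho : R, 0 < rho & exists f : R -> R, forall beta, `|beta - beta0| < rho ->
    [/\ `|f beta - gamma0| <= delta0, dsum a beta (f beta) = 0 & analytic_at f beta].
Proof.
move=> ac /andP[b00 b01] a0; set q := dsum_deriv a beta0 gamma0 => q0 delta0 delta00.
pose b := (1 + beta0) / 2; pose g := `|gamma0| + 1.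
have b1 : 0 <= b < 1 by rewrite /b; apply/andP; split; lra.
have b0 : 0 <= b by case/andP: b1.
have gg0 : 0 <= g by rewrite /g !addr_ge0.
have g0 : 0 <= g + 1 by rewrite addr_ge0.
have [K0 aK0] := ac _ _ b1 g0; have [Kg aKg] := ac _ _ b1 gg0.
pose K := Num.max K0 Kg.
have aK N : dps_abs a N b (g + 1) <= K by rewrite le_max aK0.
have aK' N : dps_abs a N b g <= K by rewrite le_max aKg orbT.
have K_ge0 : 0 <= K by apply: le_trans (aK 0%N); rewrite /dps_abs /dps /sqsum big_ord0.
have nq : 0 < `|q| by rewrite normr_gt0.
(* Radius for gamma: there the Newton map contracts by 1/2. *)
pose th := Num.min (Num.min 1 delta0) (`|q| / (4 * (K + 1))).
have th0 : 0 < th by rewrite !lt_min ltr01 delta00 divr_gt0// mulr_gt0//; lra.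
have th1 : th <= 1 by rewrite !ge_min lexx.
have thd : th <= delta0 by rewrite !ge_min lexx orbT.
have thK : th * K <= `|q| / 4.
  have : th <= `|q| / (4 * (K + 1)) by rewrite ge_min lexx orbT.
  rewrite ler_pdivlMr ?mulr_gt0//; [nra|lra].
(* Smaller radius for beta: there the Newton map sends 0 into the ball of radius
   th / 2, so the iterates never leave the ball of radius th. *)
pose th' := Num.min th (th * `|q| / (4 * (K + 1))).
have th'0 : 0 < th' by rewrite lt_min th0 divr_gt0// mulr_gt0//; lra.
have th'th : th' <= th by rewrite ge_min lexx.
have th'K : th' * K <= th * `|q| / 4.
  have : th' <= th * `|q| / (4 * (K + 1)) by rewrite ge_min lexx orbT.
  rewrite ler_pdivlMr ?mulr_gt0//; [nra|lra].
pose rho := th' * ((1 - beta0) / 2).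
have rho0 : 0 < rho by rewrite mulr_gt0// divr_gt0// subr_gt0.
have r0 := ltW rho0.
pose B : {poly R} := beta0%:P + 'X.
have nB s : th' <= s -> near_const rho s B beta0 b.
  move=> ths; have eb : b - `|beta0| = (1 - beta0) / 2 by rewrite /b ger0_norm//; lra.
  split; first by rewrite -subr_ge0 eb; lra.
    apply: le_trans (wnormD _ _ r0) _; rewrite wnormC wnormX// addrC -lerBrDr eb.
    rewrite /rho ler_piMl//; last by rewrite (le_trans th'th).
    lra.
  rewrite /B addrAC subrr add0r wnormX// eb ler_wpM2r//; lra.
have nP p : wnorm rho p <= th -> near_const rho th (gamma0%:P + p) gamma0 g.
  move=> pth; have eg : g - `|gamma0| = 1 by rewrite /g addrAC subrr add0r.
  split; first by rewrite -subr_ge0 eg.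
    apply: le_trans (wnormD _ _ r0) _; rewrite wnormC addrC -lerBrDr eg.
    exact: le_trans pth th1.
  by rewrite addrAC subrr add0r eg mulr1.
have bn : `|beta0| < 1 by rewrite ger0_norm.
have [N0 HN] : exists N0, forall N, (N0 <= N)%N ->
    `|q - dps_deriv a beta0 gamma0 N| <= `|q| / 4 /\
    `|dps a N beta0 gamma0| <= th * `|q| / 4.
  have : \forall N \near \oo, `|q - dps_deriv a beta0 gamma0 N| <= `|q| / 4 /\
    `|dps a N beta0 gamma0| <= th * `|q| / 4.
    near=> N; split; apply: ltW; near: N.
      by apply: cvgr_dist_lt; [exact: dps_deriv_cvg|rewrite divr_gt0].
    apply: (cvgr0Pnorm_lt _).1; last by rewrite divr_gt0// mulr_gt0.
    by rewrite -a0; exact: dsum_cvg.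
  by case=> N0 _ H; exists N0.
(* From the index N0 on, the truncated derivative is close to q. *)
pose Q m p := dps_poly a (N0 + m) B (gamma0%:P + p).
pose Psi m p := p - q^-1 *: Q m p.
have qV : `|q^-1| * `|q| = 1 by rewrite -normrM mulVf// normr1.
have qV0 : 0 <= `|q^-1| by [].
have contr m p1 p2 : wnorm rho p1 <= th -> wnorm rho p2 <= th ->
    wnorm rho (Psi m p1 - Psi m p2) <= wnorm rho (p1 - p2) / 2.
  move=> h1 h2; set qN := dps_deriv a beta0 gamma0 (N0 + m).
  rewrite (_ : _ - _ = q^-1 *: ((q - qN)%:P * (p1 - p2)
     - (Q m p1 - Q m p2 - qN%:P * ((gamma0%:P + p1) - (gamma0%:P + p2))))); last first.
    rewrite /Psi -!mul_polyC; move: (Q m p1) (Q m p2) => Q1 Q2.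
    rewrite -[in LHS](mul1r p1) -[in LHS](mul1r p2).
    rewrite -(_ : (q^-1)%:P * q%:P = 1); last by rewrite -polyCM mulVf.
    rewrite polyCB; ring.
  rewrite wnormZ; have [] := HN (N0 + m)%N (leq_addr _ _); rewrite -/qN => Hq _.
  have H1 := wnormM (q - qN)%:P (p1 - p2) r0; rewrite wnormC in H1.
  have := @wnorm_dps_increment _ a (N0 + m) _ _ _ _ _ _ _ _ _ r0 (ltW th0) (nB _ th'th)
     (nP _ h1) (nP _ h2).
  have e12 : gamma0%:P + p1 - (gamma0%:P + p2) = p1 - p2 by ring.
  rewrite e12 -/(Q m p1) -/(Q m p2) -/qN => H2.
  set w := wnorm rho (p1 - p2) in H1 H2 *; have w0 : 0 <= w by exact: wnorm_ge0.
  have H1' : `|q - qN| * w <= `|q| / 4 * w by rewrite ler_wpM2r.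
  have H2' : th * dps_abs a (N0 + m) b (g + 1) * w <= `|q| / 4 * w.
    by rewrite ler_wpM2r// (le_trans _ thK)// ler_wpM2l// ltW.
  have H3 := wnormB ((q - qN)%:P * (p1 - p2))
     (Q m p1 - Q m p2 - qN%:P * (p1 - p2)) r0.
  apply: (@le_trans _ _ (`|q^-1| * (`|q| / 2 * w))).
    rewrite ler_wpM2l//; lra.
  rewrite [leLHS](_ : _ = (`|q^-1| * `|q|) * (w / 2)); last by ring.
  by rewrite qV mul1r.
have start m : wnorm rho (Psi m 0) <= th / 2.
  rewrite /Psi sub0r wnormN wnormZ.
  have [_ Hd] := HN (N0 + m)%N (leq_addr _ _).
  have nc : near_const rho th' gamma0%:P gamma0 g.
    have g1 : `|gamma0| <= g by rewrite /g lerDl.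
    by split; rewrite ?wnormC// subrr wnorm0 mulr_ge0 ?subr_ge0// ltW.
  have := @wnorm_dps_near _ a (N0 + m) _ _ _ _ _ _ _ _ r0 (ltW th'0) (nB _ (lexx _)) nc.
  rewrite -[gamma0%:P]addr0 -/(Q m 0) => H.
  have H' : th' * dps_abs a (N0 + m) b g <= th' * K by rewrite ler_wpM2l// ltW.
  have HQ : wnorm rho (Q m 0) <= th * `|q| / 2.
    rewrite -(subrK (dps a (N0 + m) beta0 gamma0)%:P (Q m 0)).
    apply: le_trans (wnormD _ _ r0) _; rewrite wnormC; lra.
  apply: le_trans (ler_wpM2l qV0 HQ) _.
  rewrite [leLHS](_ : _ = (`|q^-1| * `|q|) * (th / 2)); last by ring.
  by rewrite qV mul1r.
pose G := fix G m : {poly R} := if m is m'.+1 then Psi m' (G m') else 0.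
have GS m : G m.+1 = Psi m (G m) by [].
have Gth m : wnorm rho (G m) <= th.
  elim: m => [|m IH]; first by rewrite wnorm0 ltW.
  rewrite GS -(subrK (Psi m 0) (Psi m (G m))); apply: le_trans (wnormD _ _ r0) _.
  have := contr m (G m) 0 IH; rewrite wnorm0 subr0 => /(_ (ltW th0)).
  by have := start m; lra.
pose S m := `|q^-1| * dps_abs a (N0 + m) b g.
have [T T0 GT] : exists2 T : nat -> R, T @ \oo --> 0 &
    forall m n, (m <= n)%N -> wnorm rho (G n - G m) <= T m.
  apply: (@perturbed_contraction rho G S (`|q^-1| * K) r0) => m.
    by rewrite /S ler_wpM2l.
  have -> : G m.+2 - G m.+1 = (Psi m (G m.+1) - Psi m (G m)) +
      (Psi m.+1 (G m.+1) - Psi m (G m.+1)).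
    by rewrite [RHS]addrC addrA subrK.
  apply: le_trans (wnormD _ _ r0) _; apply: lerD; first exact: contr.
  have -> : Psi m.+1 (G m.+1) - Psi m (G m.+1) =
      q^-1 *: (Q m (G m.+1) - Q m.+1 (G m.+1)).
    by rewrite /Psi scalerBr opprB addrC addrA subrK.
  rewrite wnormZ /S -mulrBr ler_wpM2l//.
  have [_ HP _] := nP _ (Gth m.+1); have [_ HB _] := nB _ th'th.
  rewrite wnormBC; apply: wnorm_dps_tail => //.
  by rewrite leq_add2l.
pose f beta := gamma0 + limn (fun m => (G m).[beta - beta0]).
have Gc beta : `|beta - beta0| < rho ->
    cvgn (fun m => (G m).[beta - beta0]) /\ `|f beta - gamma0| <= th.
  move=> hb; have Hc : cvgn (fun m => (G m).[beta - beta0]).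
    apply: (proj1 (cauchy_rate (T := T) _ T0)) => m n mn.
    rewrite -hornerN -hornerD; apply: le_trans (GT _ _ mn).
    by apply: horner_le_wnorm; exact: ltW.
  split=> //; rewrite /f addrAC subrr add0r.
  have H : (fun m => `|(G m).[beta - beta0]|) @ \oo -->
      `|limn (fun m => (G m).[beta - beta0])| by exact: cvg_norm.
  rewrite -(cvg_lim _ H)//.
  apply: limr_le; first by apply/cvg_ex; eexists; exact: H.
  apply: nearW => m; apply: le_trans (Gth m); apply: horner_le_wnorm; exact: ltW.
exists rho => //; exists f => beta hb; have [Hc Hf] := Gc _ hb; split.
- exact: le_trans Hf thd.
- have hbb : `|beta| <= b.
    have [_ HB _] := nB _ th'th; apply: le_trans HB.
    have -> : beta = B.[beta - beta0] by rewrite /B hornerD hornerC hornerX addrC subrK.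
    by apply: horner_le_wnorm; exact: ltW.
  have bb1 : `|beta| < 1 by case/andP: b1 => _; exact: le_lt_trans.
  have [U U0 HU] := dps_unif ac b1 gg0.
  pose x m := (G m).[beta - beta0].
  have xg m : `|gamma0 + x m| <= g.
    have -> : gamma0 + x m = (gamma0%:P + G m).[beta - beta0] by rewrite hornerD hornerC.
    have [_ HP _] := nP _ (Gth m); apply: le_trans HP.
    by apply: horner_le_wnorm; exact: ltW.
  have fx : (fun m => gamma0 + x m) @ \oo --> f beta.
    by apply: cvgD => //; exact: cvg_cst.
  have lim1 : (fun m => dsum a beta (gamma0 + x m)) @ \oo --> dsum a beta (f beta).
    have P : (fun m => (beta, gamma0 + x m)) @ \oo --> (beta, f beta).
      exact: (cvg_pair (cvg_cst beta) fx).
    exact: (cvg_comp _ _ P (@dsum_continuous _ a (beta, f beta) ac bb1)).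
  have xS m : dps a (N0 + m) beta (gamma0 + x m) = q * (x m - x m.+1).
    rewrite /x GS /Psi hornerD hornerN hornerZ /Q dps_horner.
    rewrite /B !hornerD !hornerC hornerX [beta0 + _]addrC subrK; field.
    by [].
  have lim2 : (fun m => dps a (N0 + m) beta (gamma0 + x m)) @ \oo --> 0.
    rewrite (_ : (fun m => _) = (fun m => q * (x m - x m.+1))); last exact/funext.
    rewrite -(mulr0 q) -(subrr (limn x)); apply: cvgM; first exact: cvg_cst.
    by apply: cvgB => //; rewrite (cvg_shiftS x).
  have lim3 : (fun m => dsum a beta (gamma0 + x m) - dps a (N0 + m) beta (gamma0 + x m))
      @ \oo --> 0.
    apply/norm_cvg0P; apply: (@squeeze_cvgr _ _ _ _ (fun=> 0) (fun m => U (N0 + m)%N)).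
    + near=> m; rewrite normr_ge0/=; have [_] := HU beta (gamma0 + x m) hbb (xg m); exact.
    + exact: cvg_cst.
    + rewrite (_ : (fun m => _) = (fun m => U (m + N0)%N)); first by rewrite cvg_shiftn.
      by apply/funext => m; rewrite addnC.
  have := cvg_unique (@norm_hausdorff _ R) lim3 (cvgB lim1 lim2).
  by rewrite subr0 => <-.
- apply: (@analytic_near_poly_lim _ (fun m => gamma0%:P + G m) T rho beta0 f rho0 _ T0) => //.
    move=> m n mn; rewrite (_ : _ - _ = G n - G m); first exact: GT.
    by ring.
  move=> y hy; rewrite (_ : (fun n => _) = (fun n => gamma0 + (G n).[y - beta0])).
    by apply: cvgD; [exact: cvg_cst|have [] := Gc _ hy].
  by apply/funext => n; rewrite hornerD hornerC.
Unshelve. all: by end_near.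
Qed.

End ImplicitFunction.

(** * Expectations under the law of a policy *)

Section Expectation.
Context {R : realType} {E U : finType} (M : mdp R E U).
Implicit Types (f g : (nat -> E) -> R) (w : nat -> E).

(** Functions of the first [n + 1] states. *)
Definition cyl n f :=
  forall w w', (forall i, (i <= n)%N -> w i = w' i) -> f w = f w'.

Definition bounded_mfun f :=
  measurable_fun [set: canonical_space M] (f : canonical_space M -> R) /\
  exists C, forall w, `|f w| <= C.

(** Any trajectory beginning with [h] would do: it is only fed to functions of the
    history. *)
Definition history_ext (x : E) n (h : n.+1.-tuple E) : nat -> E := nth x h.

Lemma history_extK x n (h : n.+1.-tuple E) : history (history_ext x h) n = h.
Proof. by apply: eq_from_tnth => i; rewrite tnth_mktuple (tnth_nth x). Qed.

Lemma history_eq w w' n :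
  history w n = history w' n <-> forall i, (i <= n)%N -> w i = w' i.
Proof.
split=> [H i ilt|H].
  by have := congr1 (fun t => tnth t (Ordinal (ilt : (i < n.+1)%N))) H;
    rewrite !tnth_mktuple.
by apply: eq_from_tnth => i; rewrite !tnth_mktuple H// -ltnS.
Qed.

Lemma cyl_ext x n f w : cyl n f -> f w = f (history_ext x (history w n)).
Proof. by apply; apply/history_eq; rewrite history_extK. Qed.

Lemma measurable_coord n y : measurable ([set w | w n = y] : set (canonical_space M)).
Proof. by apply: sub_sigma_algebra; exists n, y. Qed.

Lemma measurable_history n (h : n.+1.-tuple E) :
  measurable ([set w | history w n = h] : set (canonical_space M)).
Proof.
rewrite (_ : [set w | _] =
    \bigcap_(i in [set: 'I_n.+1]) [set w : canonical_space M | w i = tnth h i]).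
  by apply: fin_bigcap_measurable => // i _; exact: measurable_coord.
apply/seteqP; split=> [w <- i _ /=|w H]; first by rewrite tnth_mktuple.
by apply: eq_from_tnth => i; rewrite tnth_mktuple; exact: H.
Qed.

Lemma measurable_history_next n (h : n.+1.-tuple E) y :
  measurable ([set w | history w n = h /\ w n.+1 = y] : set (canonical_space M)).
Proof. by apply: measurableI; [exact: measurable_history|exact: measurable_coord]. Qed.

Lemma cyl_bounded_mfun n f : cyl n f -> bounded_mfun f.
Proof.
move=> Hf; pose x : E := enum_val (Ordinal (state_gt0 M)).
split; last first.
  exists (\sum_(h : n.+1.-tuple E) `|f (history_ext x h)|) => w.
  rewrite (cyl_ext x w Hf) (bigD1 (history w n))//= lerDl.
  exact: sumr_ge0.
move=> _ B _; rewrite setTI (_ : f @^-1` B =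
    \bigcup_(h in [set h : n.+1.-tuple E | B (f (history_ext x h))])
      [set w : canonical_space M | history w n = h]).
  by apply: fin_bigcup_measurable => // h _; exact: measurable_history.
apply/seteqP; split=> [w /= Bw|w [h /= Bh wh]].
  by exists (history w n) => //=; rewrite -(cyl_ext x w Hf).
by rewrite (cyl_ext x w Hf) wh.
Qed.

Lemma bounded_mfun_lim (F : nat -> (nat -> E) -> R) f (eps : nat -> R) :
  (forall n, bounded_mfun (F n)) -> (forall n w, `|F n w - f w| <= eps n) ->
  eps @ \oo --> 0 -> bounded_mfun f.
Proof.
move=> bF Ff e0; split.
  have mF n : measurable_fun [set: canonical_space M] (F n : canonical_space M -> R).
    by have [] := bF n.
  apply: (@measurable_fun_cvg _ (canonical_space M) R setT
    (F : nat -> canonical_space M -> R) _ mF) => w _.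
  apply/cvgrPdist_lt => d d0.
  near=> n; rewrite distrC; apply: le_lt_trans (Ff n w) _.
  apply: le_lt_trans (ler_norm _) _; near: n; exact: (cvgr0Pnorm_lt _).1 e0 _ d0.
have [_ [C FC]] := bF 0%N; exists (eps 0%N + C) => w.
rewrite -(subrK (F 0%N w) (f w)); apply: le_trans (ler_normD _ _) _.
by apply: lerD => //; rewrite distrC.
Unshelve. all: by end_near.
Qed.

Lemma bounded_mfunD f g : bounded_mfun f -> bounded_mfun g ->
  bounded_mfun (fun w => f w + g w).
Proof.
move=> [mf [C fC]] [mg [C' gC]]; split; first exact: measurable_funD.
by exists (C + C') => w; apply: le_trans (ler_normD _ _) (lerD (fC w) (gC w)).
Qed.

Lemma bounded_mfunZ c f : bounded_mfun f -> bounded_mfun (fun w => c * f w).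
Proof.
move=> [mf [C fC]]; split; first exact: measurable_funM.
by exists (`|c| * C) => w; rewrite normrM ler_wpM2l.
Qed.

Lemma bounded_mfun_cst (c : R) : bounded_mfun (fun=> c).
Proof. by split; [exact: measurable_cst|exists `|c|]. Qed.

Lemma bounded_mfun_sum (I : Type) (s : seq I) (F : I -> (nat -> E) -> R) :
  (forall i, bounded_mfun (F i)) -> bounded_mfun (fun w => \sum_(i <- s) F i w).
Proof.
move=> bF; elim: s => [|i s IH].
  by under eq_fun do rewrite big_nil; exact: bounded_mfun_cst.
by under eq_fun do rewrite big_cons; exact: bounded_mfunD.
Qed.

Section Law.
Variables (x : E) (pi : policy E U).
Let P := law M x pi.

Definition Ex f : R := fine ('E_P[f])%E.

Let ExE f : Ex f = Rintegral P [set: canonical_space M] f.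
Proof. by rewrite /Ex unlock. Qed.

Let integrable_bounded f : bounded_mfun f ->
  P.-integrable [set: canonical_space M] (EFin \o f).
Proof.
move=> [mf [C fC]]; apply: measurable_bounded_integrable => //.
  exact: le_lt_trans (probability_le1 P measurableT) (ltry 1).
exists C; split; first exact: num_real.
by move=> D CD w _; apply: le_trans (fC w) (ltW CD).
Qed.

Lemma ExD f g : bounded_mfun f -> bounded_mfun g ->
  Ex (fun w => f w + g w) = Ex f + Ex g.
Proof. by move=> bf bg; rewrite !ExE RintegralD//; exact: integrable_bounded. Qed.

Lemma ExZ c f : bounded_mfun f -> Ex (fun w => c * f w) = c * Ex f.
Proof. by move=> bf; rewrite !ExE RintegralZl//; exact: integrable_bounded. Qed.

Lemma ExB f g : bounded_mfun f -> bounded_mfun g ->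
  Ex (fun w => f w - g w) = Ex f - Ex g.
Proof. by move=> bf bg; rewrite !ExE RintegralB//; exact: integrable_bounded. Qed.

Lemma Ex_cst c : Ex (fun=> c) = c.
Proof.
by rewrite ExE Rintegral_cst//= [X in fine X](@probability_setT _ _ _ P)/= mulr1.
Qed.

Lemma Ex_sum (I : Type) (s : seq I) (F : I -> (nat -> E) -> R) :
  (forall i, bounded_mfun (F i)) ->
  Ex (fun w => \sum_(i <- s) F i w) = \sum_(i <- s) Ex (F i).
Proof.
move=> bF; elim: s => [|i s IH].
  by under eq_fun do rewrite big_nil; rewrite big_nil Ex_cst.
under eq_fun do rewrite big_cons; rewrite big_cons ExD//; first by rewrite IH.
exact: bounded_mfun_sum.
Qed.

Lemma Ex_le f g : bounded_mfun f -> bounded_mfun g -> (forall w, f w <= g w) ->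
  Ex f <= Ex g.
Proof.
by move=> bf bg fg; rewrite !ExE; apply: le_Rintegral => //; exact: integrable_bounded.
Qed.

Lemma Ex_norm_le f g : bounded_mfun f -> bounded_mfun g ->
  (forall w, `|f w| <= g w) -> `|Ex f| <= Ex g.
Proof.
move=> bf bg fg; rewrite ler_norml -mulN1r -ExZ//.
apply/andP; split; apply: Ex_le => //; first exact: bounded_mfunZ.
all: by move=> w; have := fg w; rewrite ler_norml ?mulN1r => /andP[].
Qed.

Lemma Ex_norm f C : bounded_mfun f -> (forall w, `|f w| <= C) -> `|Ex f| <= C.
Proof.
by move=> bf fC; rewrite -(Ex_cst C); apply: Ex_norm_le => //; exact: bounded_mfun_cst.
Qed.

(** Passing to the limit under the expectation, for uniform limits only: this
    reduces all expectations to those of functions of finite histories. *)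
Lemma Ex_cvg (F : nat -> (nat -> E) -> R) f (eps : nat -> R) :
  (forall n, bounded_mfun (F n)) -> (forall n w, `|F n w - f w| <= eps n) ->
  eps @ \oo --> 0 -> Ex (F n) @[n --> \oo] --> Ex f.
Proof.
move=> bF Ff e0; have bf := bounded_mfun_lim bF Ff e0.
apply/cvgrPdist_lt => d d0.
near=> n; rewrite distrC -ExB//; apply: (@le_lt_trans _ _ (eps n)).
  apply: Ex_norm => //; under eq_fun do rewrite -mulN1r.
  by apply: bounded_mfunD => //; exact: bounded_mfunZ.
apply: le_lt_trans (ler_norm _) _; near: n; exact: (cvgr0Pnorm_lt _).1 e0 _ d0.
Unshelve. all: by end_near.
Qed.

Lemma Ex_indic (A : set (canonical_space M)) : measurable A ->
  Ex (\1_A : canonical_space M -> R) = fine (P A).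
Proof. by move=> mA; rewrite /Ex expectation_indic. Qed.

Let bounded_indic (A : set (canonical_space M)) : measurable A ->
  bounded_mfun (\1_A : canonical_space M -> R).
Proof.
move=> mA; split; first exact: measurable_indic.
by exists 1 => w; rewrite indicE; case: (_ \in _); rewrite ?normr1 ?normr0.
Qed.

(** The multiplied-out Markov property, summed over histories. *)
Lemma Ex_step n (A : (nat -> E) -> R) (psi : E -> R) : cyl n A ->
  Ex (fun w => A w * psi (w n.+1)) =
  Ex (fun w => A w * \sum_y trans M (pi (history w n)) (w n) y * psi y).
Proof.
move=> cA; have [P0 PS] := lawP M x pi.
pose c (h : n.+1.-tuple E) y := A (history_ext x h) * psi y.
pose S1 (hy : n.+1.-tuple E * E) : set (canonical_space M) :=
  [set w | history w n = hy.1 /\ w n.+1 = hy.2].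
pose S0 (h : n.+1.-tuple E) : set (canonical_space M) := [set w | history w n = h].
have -> : (fun w => A w * psi (w n.+1)) =
    fun w => \sum_(hy : n.+1.-tuple E * E) c hy.1 hy.2 * \1_(S1 hy) w.
  apply/funext => w; rewrite (bigD1 (history w n, w n.+1))//= big1.
    by rewrite indicE mem_set//= mulr1 addr0 /c -(cyl_ext x w cA).
  move=> [h y] hy; rewrite indicE memNset ?mulr0// => -[/= wh wy].
  by rewrite wh wy eqxx in hy.
have -> : (fun w => A w * \sum_y trans M (pi (history w n)) (w n) y * psi y) =
    fun w => \sum_(h : n.+1.-tuple E)
      (\sum_y c h y * trans M (pi h) (tnth h ord_max) y) * \1_(S0 h) w.
  apply/funext => w; rewrite (bigD1 (history w n))//= [X in _ + X]big1.
    rewrite indicE mem_set//= mulr1 addr0 /c -(cyl_ext x w cA) tnth_mktuple mulr_sumr.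
    by apply: eq_bigr => y _; rewrite -mulrA [psi y * _]mulrC.
  move=> h hw; rewrite indicE memNset ?mulr0// => /= wh.
  by rewrite wh eqxx in hw.
have b1 hy := bounded_indic (measurable_history_next hy.1 hy.2).
have b0 h := bounded_indic (measurable_history h).
rewrite !Ex_sum; [|by move=> h; apply: bounded_mfunZ; exact: b0
  |by move=> hy; apply: bounded_mfunZ; exact: b1].
transitivity (\sum_h \sum_y c h y * Ex \1_(S1 (h, y))).
  rewrite pair_bigA/=; apply: eq_bigr => -[h y] _; rewrite ExZ//; exact: b1.
apply: eq_bigr => h _; rewrite ExZ; last exact: b0.
rewrite mulr_suml; apply: eq_bigr => y _.
rewrite !Ex_indic; [|exact: measurable_history|exact: measurable_history_next].
rewrite /S1/= PS fineM//; last by rewrite fin_num_measure//; exact: measurable_history.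
by rewrite mulrCA mulrC /=; congr (_ * _); rewrite mulrC.
Qed.

(** The initial state is [x] almost surely. *)
Lemma Ex_start f : cyl 0 f -> Ex f = f (fun=> x).
Proof.
move=> cf; have [P0 _] := lawP M x pi.
pose S : set (canonical_space M) := [set w | w 0%N = x].
have mS : measurable S by exact: measurable_coord.
pose N : set (canonical_space M) := ~` S.
have mN : measurable N by exact: measurableC.
rewrite [in RHS](_ : f _ = Ex (fun=> f (fun=> x))); last by rewrite Ex_cst.
apply/eqP; rewrite -subr_eq0.
have bf := cyl_bounded_mfun cf; have bc := bounded_mfun_cst (f (fun=> x)).
have [C fC] := proj2 bf.
have C0 : 0 <= C by apply: le_trans (fC (fun=> x)).
rewrite -ExB// -normr_le0.
have ExN : Ex (\1_N : canonical_space M -> R) = 0.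
  by rewrite Ex_indic// probability_setC// P0 subee.
have H w : `|f w - f (fun=> x)| <= 2 * C * \1_N w.
  rewrite indicE; have [wS|wS] := pselect (S w).
    rewrite memNset ?mulr0; last by move=> /(_ wS).
    rewrite (cf w (fun=> x)) ?subrr ?normr0// => i; rewrite leqn0 => /eqP ->; exact: wS.
  rewrite mem_set// mulr1; apply: le_trans (ler_normB _ _) _.
  by have := fC w; have := fC (fun=> x); lra.
have bN := bounded_mfunZ (2 * C) (bounded_indic mN).
have bB : bounded_mfun (fun w => f w - f (fun=> x)).
  by apply: (bounded_mfunD bf (bounded_mfun_cst (- f (fun=> x)))).
have EN : Ex (fun w => 2 * C * \1_N w) = 0 by rewrite ExZ ?ExN ?mulr0//; exact: bounded_indic.
by rewrite -EN; exact: Ex_norm_le.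
Qed.

End Law.
End Expectation.

(** * The exponential utility function *)

Section ExponentialBounds.
Context {R : realType}.
Implicit Types (gamma L s t : R).

Lemma exp_partial_le (z : R) N : 0 <= z -> \sum_(k < N) z ^+ k / k`!%:R <= expR z.
Proof.
move=> z0; rewrite -(big_mkord xpredT (fun k => z ^+ k / k`!%:R)).
apply: (nondecreasing_cvgn_le (u_ := series (exp_coeff z))); last first.
  exact: is_cvg_series_exp_coeff.
by apply: nondecreasing_series => n _ _; exact: exp_coeff_ge0.
Qed.

Lemma expR_lipschitz (K s t : R) : s <= K -> t <= K ->
  `|expR s - expR t| <= expR K * `|s - t|.
Proof.
wlog st : s t / s <= t => [H sK tK|sK tK].
  have [st|/ltW ts] := leP s t; first exact: H.
  by rewrite distrC [X in _ * X]distrC; exact: H.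
rewrite distrC [X in _ * X]distrC !ger0_norm ?subr_ge0 ?ler_expR//.
apply: (@le_trans _ _ (expR t * (t - s))); last by rewrite ler_wpM2r ?subr_ge0 ?ler_expR.
have -> : expR s = expR t * expR (s - t) by rewrite -expRD addrC subrK.
rewrite -{1}[expR t]mulr1 -mulrBr ler_wpM2l ?expR_ge0//.
by have := expR_ge1Dx (s - t); lra.
Qed.

(** The exponential utility, normalized so as to extend analytically to
    [gamma = 0], where it is the identity. *)
Definition exp_util gamma s : R :=
  if gamma == 0 then s else gamma^-1 * (expR (gamma * s) - 1).

(** Partial sums of (exp (gamma s) - 1) / gamma, in which the division has been
    carried out. *)
Definition exp_util_trunc gamma s N : R :=
  \sum_(k < N) gamma ^+ k * (s ^+ k.+1 / k.+1`!%:R).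

Lemma exp_util_cvg gamma s : exp_util_trunc gamma s @ \oo --> exp_util gamma s.
Proof.
rewrite /exp_util; have [->|g0] := eqVneq gamma 0.
  apply: cvg_near_cst; near=> N.
  have [n ->] : exists n, N = n.+1.
    by exists N.-1; rewrite prednK//; near: N; exists 1%N.
  rewrite /exp_util_trunc big_ord_recl big1 ?addr0 => [|i _].
    by rewrite expr0 mul1r expr1 divr1.
  by rewrite lift0 expr0n mul0r.
have H : (fun N => gamma^-1 * (series (exp_coeff (gamma * s)) N.+1 - 1)) @ \oo -->
    gamma^-1 * (expR (gamma * s) - 1).
  apply: cvgM; first exact: cvg_cst.
  apply: cvgB; last exact: cvg_cst.
  by rewrite (cvg_shiftS (series (exp_coeff (gamma * s)))); exact: is_cvg_series_exp_coeff.
rewrite (_ : exp_util_trunc gamma s =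
   (fun N => gamma^-1 * (series (exp_coeff (gamma * s)) N.+1 - 1))); first exact: H.
apply/funext => N; rewrite /series/= big_mkord big_ord_recl /exp_coeff /= expr0 divr1.
rewrite addrAC subrr add0r mulr_sumr; apply: eq_bigr => i _.
rewrite /bump/= add1n exprMn [in RHS]exprS; field.
by rewrite g0 pnatr_eq0 -lt0n fact_gt0.
Unshelve. all: by end_near.
Qed.

Lemma util_partial_le gamma L N : 0 <= gamma -> 0 <= L ->
  \sum_(k < N) gamma ^+ k * (L ^+ k.+1 / k.+1`!%:R) <= L * expR (gamma * L).
Proof.
move=> g0 L0; apply: le_trans (ler_wpM2l L0 (exp_partial_le N (mulr_ge0 g0 L0))).
rewrite mulr_sumr; apply: ler_sum => k _.
rewrite [leRHS](_ : _ = gamma ^+ k * (L ^+ k.+1 / k`!%:R)); last first.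
  by rewrite exprMn exprS; ring.
rewrite ler_wpM2l ?exprn_ge0// ler_wpM2l ?exprn_ge0//.
rewrite lef_pV2 ?posrE ?ltr0n ?fact_gt0// ler_nat factS.
by rewrite leq_pmull.
Qed.

Lemma exp_util_unif gamma L : 0 <= L ->
  exists2 T : nat -> R, T @ \oo --> 0 &
    forall s, `|s| <= L -> forall N, `|exp_util_trunc gamma s N - exp_util gamma s| <= T N.
Proof.
move=> L0; pose S N := \sum_(k < N) `|gamma| ^+ k * (L ^+ k.+1 / k.+1`!%:R).
have St (s : R) m n : `|s| <= L -> (m <= n)%N ->
    `|exp_util_trunc gamma s n - exp_util_trunc gamma s m| <= S n - S m.
  move=> sL; elim: n => [|n IH]; first by rewrite leqn0 => /eqP ->; rewrite !subrr normr0.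
  rewrite leq_eqVlt => /predU1P[->|]; first by rewrite !subrr normr0.
  rewrite ltnS => /IH {}IH; rewrite /exp_util_trunc /S !big_ord_recr/=.
  rewrite addrAC [leRHS]addrAC; apply: le_trans (ler_normD _ _) _.
  apply: lerD => //; rewrite !normrM !normrX normfV normr_nat.
  rewrite ler_wpM2l ?exprn_ge0// ler_wpM2r ?invr_ge0 ?ler0n//.
  by rewrite lerXn2r ?nnegrE.
have [T T0 ST] := @monotone_tail _ S (L * expR (`|gamma| * L)) (fun m n mn =>
  etrans (esym (subr_ge0 _ _)) (le_trans (normr_ge0 _) (St 0 _ _ (etrans (f_equal (fun z => z <= L) (normr0 _)) L0) mn)))
  (fun n => util_partial_le n (normr_ge0 gamma) L0).
exists T => // s sL N.
have [_ H] := cauchy_rate (fun m n mn => le_trans (St s m n sL mn) (ST _ _ mn)) T0.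
have := H N; rewrite distrC; congr (`|_ - _| <= _).
by apply: cvg_lim => //; exact: exp_util_cvg.
Qed.

Lemma exp_util_lipschitz gamma L s t : `|s| <= L -> `|t| <= L ->
  `|exp_util gamma s - exp_util gamma t| <= expR (`|gamma| * L) * `|s - t|.
Proof.
move=> sL tL; have L0 := le_trans (normr_ge0 s) sL.
rewrite /exp_util; have [->|g0] := eqVneq gamma 0.
  by rewrite normr0 mul0r expR0 mul1r.
rewrite -mulrBr opprB addrA subrK normrM normfV.
have B z : `|z| <= L -> gamma * z <= `|gamma| * L.
  by move=> zL; apply: le_trans (ler_norm _) _; rewrite normrM ler_wpM2l.
have := expR_lipschitz (B _ sL) (B _ tL); rewrite -mulrBr normrM.
rewrite mulrCA => H; rewrite mulrC ler_pdivrMr ?normr_gt0//.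
by rewrite [leRHS]mulrC.
Qed.

End ExponentialBounds.

(** * Expected utility of the discounted reward *)

Section Utility.
Context {R : realType} {E U : finType} (M : mdp R E U).

Definition reward_bound : R := \sum_(z : E) \sum_(a : U) `|reward M z a|.

Lemma reward_le z a : `|reward M z a| <= reward_bound.
Proof.
rewrite /reward_bound (bigD1 z)//= (bigD1 a)//= -addrA lerDl.
by apply: addr_ge0; apply: sumr_ge0 => // i _; exact: sumr_ge0.
Qed.

Lemma reward_bound_ge0 : 0 <= reward_bound.
Proof. by apply: sumr_ge0 => z _; exact: sumr_ge0. Qed.

Definition disc_bound (b : R) : R := reward_bound / (1 - b).

Lemma disc_bound_ge0 b : b < 1 -> 0 <= disc_bound b.
Proof. by move=> b1; rewrite divr_ge0 ?reward_bound_ge0// subr_ge0 ltW. Qed.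

Lemma geometric_le (b : R) n : 0 <= b < 1 ->
  \sum_(i < n) reward_bound * b ^+ i <= disc_bound b.
Proof.
move=> /andP[b0 b1]; rewrite -mulr_sumr ler_wpM2l ?reward_bound_ge0//.
rewrite -[leRHS]mul1r ler_pdivlMr ?subr_gt0// -[1 - b]opprB mulrN mulrC -subrX1.
by rewrite opprB lerBlDr lerDl exprn_ge0.
Qed.

Section Policy.
Variables (x : E) (pi : policy E U).
Implicit Types (w : nat -> E) (beta gamma b : R).

Definition step_reward i w : R := reward M (w i) (pi (history w i)).

(** The discounted reward is the power series in [beta] with these coefficients,
    of radius at least 1 since rewards are bounded. *)
Definition reward_poly n w : {poly R} := \poly_(i < n) step_reward i w.

Definition disc_sum beta n w : R := (reward_poly n w).[beta].

Lemma disc_sumE beta n w : disc_sum beta n w = \sum_(i < n) step_reward i w * beta ^+ i.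
Proof. by rewrite /disc_sum horner_poly. Qed.

Lemma cyl_step_reward i : cyl i (step_reward i).
Proof.
move=> w w' H; rewrite /step_reward (H i)//.
by rewrite (proj2 (history_eq w w' i) H).
Qed.

Lemma cyl_reward_poly n w w' : (forall i, (i < n)%N -> w i = w' i) ->
  reward_poly n w = reward_poly n w'.
Proof.
move=> H; apply/polyP => i; rewrite !coef_poly; case: ltnP => // ilt.
by apply: cyl_step_reward => j ji; apply: H; exact: leq_ltn_trans ilt.
Qed.

Lemma cyl_disc_sum beta n : cyl n.-1 (disc_sum beta n).
Proof.
move=> w w' H; rewrite /disc_sum (@cyl_reward_poly n w w')// => i ilt; apply: H.
by case: n ilt.
Qed.

Lemma wnorm_reward_poly b n w : 0 <= b < 1 -> wnorm b (reward_poly n w) <= disc_bound b.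
Proof.
move=> b1; apply: le_trans (geometric_le n b1); have /andP[b0 _] := b1.
rewrite (@wnorm_wide _ b _ n) ?size_poly//; apply: ler_sum => i _.
by rewrite coef_poly ltn_ord ler_wpM2r ?exprn_ge0// reward_le.
Qed.

Lemma disc_sum_le beta n w : 0 <= beta < 1 -> `|disc_sum beta n w| <= disc_bound beta.
Proof.
move=> b1; apply: le_trans (wnorm_reward_poly n w b1); apply: horner_le_wnorm.
by rewrite ger0_norm//; case/andP: b1.
Qed.

Lemma disc_sum_unif beta : 0 <= beta < 1 ->
  exists2 T : nat -> R, T @ \oo --> 0 &
    forall w n, `|disc_sum beta n w - discounted_reward M beta pi w| <= T n.
Proof.
move=> b1; have /andP[b0 _] := b1.
pose S n := \sum_(i < n) reward_bound * beta ^+ i.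
have SB w m n : (m <= n)%N -> `|disc_sum beta n w - disc_sum beta m w| <= S n - S m.
  rewrite !disc_sumE; elim: n => [|n IH].
    by rewrite leqn0 => /eqP ->; rewrite !subrr normr0.
  rewrite leq_eqVlt => /predU1P[->|]; first by rewrite !subrr normr0.
  rewrite ltnS => /IH {}IH; rewrite /S !big_ord_recr/= addrAC [leRHS]addrAC.
  apply: le_trans (ler_normD _ _) _; apply: lerD => //.
  by rewrite normrM normrX (ger0_norm b0) ler_wpM2r ?exprn_ge0// reward_le.
have [T T0 ST] := @monotone_tail _ S (disc_bound beta) (fun m n mn =>
  etrans (esym (subr_ge0 _ _)) (le_trans (normr_ge0 _)
    (SB (fun=> enum_val (Ordinal (state_gt0 M))) _ _ mn)))
  (fun n => geometric_le n b1).
exists T => // w n.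
have [_ H] := cauchy_rate (fun m n mn => le_trans (SB w m n mn) (ST _ _ mn)) T0.
have := H n; rewrite distrC; congr (`|_ - _| <= _).
rewrite /discounted_reward; congr (limn _); apply/funext => k.
rewrite disc_sumE /series/= big_mkord; apply: eq_bigr => i _.
by rewrite mulrC.
Qed.

Lemma discounted_reward_le beta w : 0 <= beta < 1 ->
  `|discounted_reward M beta pi w| <= disc_bound beta.
Proof.
move=> b1; have [T T0 H] := disc_sum_unif b1.
have Hc : (fun n => `|disc_sum beta n w|) @ \oo --> `|discounted_reward M beta pi w|.
  apply: cvg_norm; apply/cvgrPdist_lt => d d0; near=> n; rewrite distrC.
  apply: le_lt_trans (H w n) _; apply: le_lt_trans (ler_norm _) _.
  near: n; exact: (cvgr0Pnorm_lt _).1 T0 _ d0.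
rewrite -(cvg_lim _ Hc)//; apply: limr_le; first by apply/cvg_ex; eexists; exact: Hc.
by apply: nearW => n; exact: disc_sum_le.
Unshelve. all: by end_near.
Qed.

Let Exp := Ex M x pi.

(** Expected exponential utility: [J] is an increasing function of it, and
    unlike [J] it is given by a globally convergent double power series. *)
Definition util beta gamma : R :=
  Exp (fun w => exp_util gamma (discounted_reward M beta pi w)).

Definition exp_reward beta gamma : R :=
  Exp (fun w => expR (gamma * discounted_reward M beta pi w)).

(** A Lipschitz function of the discounted reward is the uniform limit of the same
    function of the truncated sums, hence measurable. *)
Lemma bounded_mfun_unif beta (phi : R -> R) K : 0 <= beta < 1 ->
  (forall s t, `|s| <= disc_bound beta -> `|t| <= disc_bound beta ->
    `|phi s - phi t| <= K * `|s - t|) -> 0 <= K ->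
  bounded_mfun M (fun w => phi (discounted_reward M beta pi w)).
Proof.
move=> b1 phiK K0; have [T T0 H] := disc_sum_unif b1.
apply: (@bounded_mfun_lim _ _ _ M (fun n w => phi (disc_sum beta n w)) _
  (fun n => K * T n)).
- move=> n; apply: (@cyl_bounded_mfun _ _ _ M n.-1) => w w' ww.
  by rewrite (@cyl_disc_sum beta n w w' ww).
- move=> n w; apply: le_trans (phiK _ _ (disc_sum_le n w b1) (discounted_reward_le w b1)) _.
  by rewrite ler_wpM2l.
- by rewrite -(mulr0 K); apply: cvgM => //; exact: cvg_cst.
Qed.

Lemma bounded_mfun_exp beta gamma : 0 <= beta < 1 ->
  bounded_mfun M (fun w => expR (gamma * discounted_reward M beta pi w)).
Proof.
move=> b1; set L := disc_bound beta.
apply: (@bounded_mfun_unif beta (fun s => expR (gamma * s)) (expR (`|gamma| * L) * `|gamma|) b1).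
  move=> s t sL tL; rewrite -mulrA -normrM mulrBr; apply: expR_lipschitz;
    by apply: le_trans (ler_norm _) _; rewrite normrM ler_wpM2l.
by rewrite mulr_ge0 ?expR_ge0.
Qed.

Lemma bounded_mfun_exp_util beta gamma : 0 <= beta < 1 ->
  bounded_mfun M (fun w => exp_util gamma (discounted_reward M beta pi w)).
Proof.
move=> b1; apply: (bounded_mfun_unif b1 (K := expR (`|gamma| * disc_bound beta))).
  by move=> s t; exact: exp_util_lipschitz.
exact: expR_ge0.
Qed.

Lemma exp_rewardE beta gamma : 0 <= beta < 1 ->
  exp_reward beta gamma = 1 + gamma * util beta gamma.
Proof.
move=> b1; rewrite /util /Exp -ExZ; last exact: bounded_mfun_exp_util.
rewrite -[X in X + _](Ex_cst M x pi 1) -ExD; [|exact: bounded_mfun_cst|].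
  congr (Ex _ _ _ _); apply/funext => w; rewrite /exp_util.
  have [->|g0] := eqVneq gamma 0; first by rewrite !mul0r expR0 addr0.
  by rewrite mulrA mulfV// mul1r addrC subrK.
by apply: bounded_mfunZ; exact: bounded_mfun_exp_util.
Qed.

Lemma exp_reward_bounds beta gamma : 0 <= beta < 1 ->
  expR (- (`|gamma| * disc_bound beta)) <= exp_reward beta gamma <=
    expR (`|gamma| * disc_bound beta).
Proof.
move=> b1; rewrite -[X in X <= _ <= _](Ex_cst M x pi) -[X in _ <= _ <= X](Ex_cst M x pi).
have B w : `|gamma * discounted_reward M beta pi w| <= `|gamma| * disc_bound beta.
  by rewrite normrM ler_wpM2l// discounted_reward_le.
apply/andP; split; apply: Ex_le; do ?exact: bounded_mfun_cst;
  do ?exact: bounded_mfun_exp; move=> w; rewrite ler_expR;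
  by have := B w; rewrite ler_norml => /andP[].
Qed.

Lemma J_exp_reward beta gamma : 0 <= beta < 1 ->
  J M gamma x pi beta =
    if gamma == 0 then util beta gamma else gamma^-1 * ln (exp_reward beta gamma).
Proof.
move=> b1; rewrite /J; case: ifPn => // /eqP ->.
rewrite /util /Exp /Ex; congr (fine (expectation _ _)).
by apply/funext => w; rewrite /exp_util eqxx.
Qed.

(** ** The double power series of the utility *)

(** Along a trajectory, the coefficient of [beta ^+ j * gamma ^+ k]. It involves
    the first [j + 1] rewards only, hence the truncation of the polynomial. *)
Definition util_coef_path j k w : R :=
  (reward_poly j.+1 w ^+ k.+1)`_j / k.+1`!%:R.

Definition util_coef j k : R := Exp (util_coef_path j k).

Lemma coef_exp_eq (p q : {poly R}) j k : (forall i, (i <= j)%N -> p`_i = q`_i) ->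
  forall i, (i <= j)%N -> (p ^+ k)`_i = (q ^+ k)`_i.
Proof.
move=> pq; elim: k => [|k IH] i ij; first by rewrite !expr0.
rewrite !exprS !coefM; apply: eq_bigr => l _; rewrite pq ?IH//.
  exact: leq_trans (leq_subr _ _) ij.
by apply: leq_trans ij; rewrite -ltnS.
Qed.

Lemma coef_reward_poly n j k w : (j < n)%N ->
  (reward_poly n w ^+ k)`_j = (reward_poly j.+1 w ^+ k)`_j.
Proof.
move=> jn; apply: (@coef_exp_eq _ _ j) => // i ij.
by rewrite !coef_poly ltnS ij (leq_ltn_trans ij jn).
Qed.

Lemma cyl_util_coef_path j k : cyl j (util_coef_path j k).
Proof. by move=> w w' H; rewrite /util_coef_path (@cyl_reward_poly j.+1 w w'). Qed.

Lemma bounded_util_coef_path j k : bounded_mfun M (util_coef_path j k).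
Proof. exact: cyl_bounded_mfun (@cyl_util_coef_path j k). Qed.

Lemma wnorm_reward_poly_exp b n k w : 0 <= b < 1 ->
  wnorm b (reward_poly n w ^+ k) <= disc_bound b ^+ k.
Proof.
move=> b1; have /andP[b0 bl] := b1; apply: le_trans (wnormXn _ _ b0) _.
by rewrite lerXn2r ?nnegrE ?wnorm_ge0 ?disc_bound_ge0 ?wnorm_reward_poly.
Qed.

Lemma util_coef_path_abs b g N w : 0 <= b < 1 -> 0 <= g ->
  dps_abs (fun j k => util_coef_path j k w) N b g <=
    disc_bound b * expR (g * disc_bound b).
Proof.
move=> b1 g0; have /andP[b0 bl] := b1.
apply: le_trans (util_partial_le N g0 (disc_bound_ge0 bl)).
rewrite /dps_abs /dps /sqsum exchange_big/=; apply: ler_sum => k _.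
rewrite -mulr_suml mulrC ler_wpM2l ?exprn_ge0//.
rewrite (eq_bigr (fun j : 'I_N => `|(reward_poly N w ^+ k.+1)`_j| * b ^+ j / k.+1`!%:R)).
  rewrite -mulr_suml ler_wpM2r ?invr_ge0 ?ler0n//.
  exact: le_trans (wnorm_trunc_le _ _ b0) (wnorm_reward_poly_exp _ _ _ b1).
move=> j _; rewrite /util_coef_path -(coef_reward_poly _ _ (ltn_ord j)).
by rewrite normrM normfV normr_nat mulrAC.
Qed.

(** The bound holds trajectory by trajectory and is then averaged. *)
Lemma abs_conv_util : abs_conv util_coef.
Proof.
move=> b g b1 g0; have /andP[b0 bl] := b1.
exists (disc_bound b * expR (g * disc_bound b)) => N.
have bc j k : bounded_mfun M (fun w => `|util_coef_path j k w| * b ^+ j * g ^+ k).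
  apply: (@cyl_bounded_mfun _ _ _ M j) => w w' H.
  by rewrite (@cyl_util_coef_path j k w w' H).
have -> : dps_abs util_coef N b g = \sum_(j < N) \sum_(k < N) `|util_coef j k| * b ^+ j * g ^+ k by [].
rewrite -(Ex_cst M x pi (disc_bound b * _)).
apply: (@le_trans _ _ (Exp (fun w => dps_abs (fun j k => util_coef_path j k w) N b g))).
  rewrite /Exp /dps_abs /dps /sqsum Ex_sum; last by move=> j; exact: bounded_mfun_sum.
  apply: ler_sum => j _; rewrite Ex_sum//; apply: ler_sum => k _.
  have ba : bounded_mfun M (fun w => `|util_coef_path j k w|).
    apply: (@cyl_bounded_mfun _ _ _ M j) => w w' H.
    by rewrite (@cyl_util_coef_path j k w w' H).
  under [X in _ <= Ex _ _ _ X]eq_fun do rewrite -mulrA mulrC.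
  rewrite ExZ// -mulrA mulrC ler_wpM2l ?mulr_ge0 ?exprn_ge0//.
  by apply: Ex_norm_le => //; exact: bounded_util_coef_path.
apply: Ex_le; [|exact: bounded_mfun_cst|].
  by apply: bounded_mfun_sum => j; exact: bounded_mfun_sum.
by move=> w; exact: util_coef_path_abs.
Qed.

Lemma horner_trunc_le (p : {poly R}) beta b N : 0 <= beta <= b -> 0 < b ->
  `|\sum_(j < N) p`_j * beta ^+ j - p.[beta]| <= (beta / b) ^+ N * wnorm b p.
Proof.
move=> /andP[b0 bb] bp; pose n := maxn N (size p).
have Nn : (N <= n)%N by rewrite leq_maxl.
have q0 : 0 <= beta / b by rewrite divr_ge0// ltW.
have q1 : beta / b <= 1 by rewrite ler_pdivrMr// mul1r.
rewrite (@horner_coef_wide _ n) ?leq_maxr// (@wnorm_wide _ b p n) ?leq_maxr//.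
rewrite (big_ord_widen _ (fun j => p`_j * beta ^+ j) Nn) big_mkcond -sumrB mulr_sumr.
apply: le_trans (ler_norm_sum _ _ _) _; apply: ler_sum => j _; case: ltnP => jN.
  by rewrite subrr normr0 !mulr_ge0 ?exprn_ge0// ltW.
rewrite sub0r normrN normrM normrX (ger0_norm b0) mulrCA ler_wpM2l//.
have -> : beta ^+ j = (beta / b) ^+ (j - N) * ((beta / b) ^+ N * b ^+ j).
  by rewrite mulrA -exprD subnK// -exprMn divfK// gt_eqF.
by rewrite ler_piMl ?exprn_ile1// !mulr_ge0 ?exprn_ge0// ltW.
Qed.

(** Along a trajectory the truncated double series differs from the utility by
    three errors, each tending to 0 uniformly: the powers of beta beyond [N] in
    the powers of the truncated reward, the powers of gamma beyond [N], and the
    rewards after time [N]. *)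
Lemma dsum_util beta gamma : 0 < beta < 1 -> dsum util_coef beta gamma = util beta gamma.
Proof.
move=> /andP[b0 b1]; have bb1 : 0 <= beta < 1 by rewrite ltW.
pose b := (1 + beta) / 2; pose L := disc_bound b; pose q := beta / b.
have bl : 0 <= b < 1 by rewrite /b; apply/andP; split; lra.
have bp : 0 < b by rewrite /b; lra.
have betab : 0 <= beta <= b by rewrite /b; apply/andP; split; lra.
have L0 : 0 <= L by apply: disc_bound_ge0; case/andP: bl.
have [T1 T10 H1] := exp_util_unif gamma (disc_bound_ge0 b1).
have [T2 T20 H2] := disc_sum_unif bb1.
set K := expR (`|gamma| * disc_bound beta).
have q0 : 0 <= q by rewrite divr_ge0// ltW.
have q1 : q < 1 by rewrite ltr_pdivrMr// mul1r /b; lra.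
apply: cvg_lim => //.
have dE N : dps util_coef N beta gamma =
    Exp (fun w => dps (fun j k => util_coef_path j k w) N beta gamma).
  have bc j k : bounded_mfun M (fun w => util_coef_path j k w * beta ^+ j * gamma ^+ k).
    apply: (@cyl_bounded_mfun _ _ _ M j) => w w' H.
    by rewrite (@cyl_util_coef_path j k w w' H).
  rewrite /Exp /dps /sqsum Ex_sum; last by move=> j; exact: bounded_mfun_sum.
  apply: eq_bigr => j _; rewrite Ex_sum//; apply: eq_bigr => k _.
  under eq_fun do rewrite -mulrA mulrC.
  rewrite ExZ; last exact: bounded_util_coef_path.
  by rewrite -mulrA mulrC.
rewrite (_ : (fun N => _) = fun N =>
    Exp (fun w => dps (fun j k => util_coef_path j k w) N beta gamma)); last exact/funext.
apply: (@Ex_cvg _ _ _ M x pi _ _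
  (fun N => q ^+ N * (L * expR (`|gamma| * L)) + T1 N + K * T2 N)).
- move=> N; apply: (@cyl_bounded_mfun _ _ _ M N) => w w' H.
  apply: eq_bigr => j _; apply: eq_bigr => k _; congr (_ * _ * _).
  apply: cyl_util_coef_path => i ij; apply: H.
  by apply: leq_trans ij (ltnW (ltn_ord j)).
- move=> N w; set G := discounted_reward M beta pi w; set s := disc_sum beta N w.
  have -> : forall u, u - exp_util gamma G = (u - exp_util_trunc gamma s N) +
     (exp_util_trunc gamma s N - exp_util gamma s) + (exp_util gamma s - exp_util gamma G).
    by move=> u; ring.
  have sL : `|s| <= disc_bound beta by exact: disc_sum_le.
  have GL : `|G| <= disc_bound beta by exact: discounted_reward_le.
  apply: le_trans (ler_normD _ _) _; apply: lerD; last first.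
    apply: le_trans (exp_util_lipschitz gamma sL GL) _.
    by rewrite ler_wpM2l ?expR_ge0//; exact: H2.
  apply: le_trans (ler_normD _ _) _; apply: lerD; last exact: H1.
  have -> : dps (fun j k => util_coef_path j k w) N beta gamma =
      \sum_(k < N) gamma ^+ k *
       ((\sum_(j < N) (reward_poly N w ^+ k.+1)`_j * beta ^+ j) / k.+1`!%:R).
    rewrite /dps /sqsum exchange_big/=; apply: eq_bigr => k _.
    rewrite mulr_suml mulr_sumr; apply: eq_bigr => j _.
    by rewrite /util_coef_path -(coef_reward_poly _ _ (ltn_ord j)); ring.
  rewrite /exp_util_trunc -sumrB; apply: le_trans (ler_norm_sum _ _ _) _.
  apply: (@le_trans _ _ (q ^+ N * \sum_(k < N) `|gamma| ^+ k * (L ^+ k.+1 / k.+1`!%:R))).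
    rewrite mulr_sumr; apply: ler_sum => k _.
    rewrite -mulrBr -mulrBl !normrM normrX normfV normr_nat [leRHS]mulrCA.
    rewrite ler_wpM2l ?exprn_ge0// mulrA ler_wpM2r ?invr_ge0 ?ler0n//.
    rewrite /s /disc_sum -horner_exp.
    apply: le_trans (horner_trunc_le _ _ betab bp) _.
    by rewrite ler_wpM2l ?exprn_ge0// wnorm_reward_poly_exp.
  by rewrite ler_wpM2l ?exprn_ge0// util_partial_le.
- rewrite -[X in _ --> X](_ : 0 * (L * expR (`|gamma| * L)) + 0 + K * 0 = 0); last by rewrite mul0r mulr0 !addr0.
  apply: cvgD; [apply: cvgD => //|].
    apply: cvgM; last exact: cvg_cst.
    by apply: cvg_expr; rewrite ger0_norm.
  by apply: cvgM => //; exact: cvg_cst.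
Qed.

End Policy.
End Utility.

(** * Optimality and one-step deviations *)

(* Unqualified, this name would denote Markov's inequality. *)
Local Notation markov := Defs.markov.

Section Verification.
Context {R : realType} {E U : finType} (M : mdp R E U).
Implicit Types (x y z : E) (pi : policy E U) (beta gamma : R) (w : nat -> E).

Lemma exp_reward_gt0 x pi beta gamma : 0 <= beta < 1 ->
  0 < exp_reward M x pi beta gamma.
Proof.
move=> b1; have /andP[+ _] := exp_reward_bounds M x pi gamma b1.
by apply: lt_le_trans; exact: expR_gt0.
Qed.

(** Across policies and initial states, [J] and the expected utility order
    alike, for either sign of [gamma]. *)
Lemma J_le_util x pi x' pi' beta gamma : 0 <= beta < 1 ->
  (J M gamma x pi beta <= J M gamma x' pi' beta) =
  (util M x pi beta gamma <= util M x' pi' beta gamma).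
Proof.
move=> b1; rewrite !J_exp_reward//; case: ifPn => // g0.
have pos y p := exp_reward_gt0 y p gamma b1.
case: (ltgtP gamma 0) g0 => // g0 _.
  rewrite ler_nM2l ?invr_lt0// ler_ln ?posrE// !exp_rewardE// lerD2l.
  by rewrite ler_nM2l.
rewrite ler_pM2l ?invr_gt0// ler_ln ?posrE// !exp_rewardE// lerD2l.
by rewrite ler_pM2l.
Qed.

Lemma exp_reward_le x pi x' pi' beta gamma : 0 <= beta < 1 -> gamma < 0 ->
  (exp_reward M x pi beta gamma <= exp_reward M x' pi' beta gamma) =
  (J M gamma x' pi' beta <= J M gamma x pi beta).
Proof. by move=> b1 g0; rewrite J_le_util// !exp_rewardE// lerD2l ler_nM2l. Qed.

Lemma exp_reward_near1 x pi beta gamma g : 0 <= beta < 1 -> `|gamma| <= g ->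
  `|exp_reward M x pi beta gamma - 1| <=
    expR (g * disc_bound M beta) * (`|gamma| * disc_bound M beta).
Proof.
move=> b1 gg; rewrite -(Ex_cst M x pi 1) -ExB; last exact: bounded_mfun_cst.
  apply: Ex_norm => [|w].
    by apply: (bounded_mfunD (bounded_mfun_exp M pi gamma b1) (bounded_mfun_cst M (- 1))).
  have L0 := @discounted_reward_le R E U M pi beta w b1.
  have Lp := le_trans (normr_ge0 _) L0.
  have gL : `|gamma * discounted_reward M beta pi w| <= `|gamma| * disc_bound M beta.
    by rewrite normrM ler_wpM2l.
  have gL' : `|gamma| * disc_bound M beta <= g * disc_bound M beta by rewrite ler_wpM2r.
  rewrite -expR0; apply: le_trans (@expR_lipschitz _ (g * disc_bound M beta) _ _ _ _) _.
  - exact: le_trans (ler_norm _) (le_trans gL gL').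
  - by apply: le_trans gL'; rewrite mulr_ge0.
  - by rewrite subr0 ler_wpM2l ?expR_ge0.
exact: bounded_mfun_exp.
Qed.

(** One step of the multiplicative dynamic programming operator. *)
Definition bellman gamma (a : U) z (psi : E -> R) : R :=
  expR (gamma * reward M z a) * \sum_y trans M a z y * psi y.

(** Exponential value of the first [n] rewards followed by a terminal value. *)
Definition stage x pi beta gamma n (psi : E -> R) : R :=
  Ex M x pi (fun w => expR (gamma * disc_sum M pi beta n w) * psi (w n)).

Lemma cyl_stage pi beta gamma n (f : (nat -> E) -> R) : cyl n f ->
  cyl n (fun w => expR (gamma * disc_sum M pi beta n w) * f w).
Proof.
move=> cf w w' H; rewrite (cf w w')// (@cyl_disc_sum _ _ _ M pi beta n w w')// => i ij.
by apply: H; exact: leq_trans ij (leq_pred n).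
Qed.

Lemma stageS x pi beta gamma n psi :
  stage x pi beta gamma n.+1 psi =
  Ex M x pi (fun w => expR (gamma * disc_sum M pi beta n w) *
    bellman (gamma * beta ^+ n) (pi n (history w n)) (w n) psi).
Proof.
rewrite /stage (@Ex_step _ _ _ M x pi n (fun w => expR (gamma * disc_sum M pi beta n.+1 w))).
  congr (Ex _ _ _ _); apply/funext => w; rewrite /bellman mulrA -expRD.
  congr (expR _ * _); rewrite !disc_sumE big_ord_recr/= mulrDr; congr (_ + _).
  by rewrite /step_reward mulrA mulrAC.
move=> w w' H; congr (expR (_ * _)).
exact: (@cyl_disc_sum _ _ _ M pi beta n.+1 w w').
Qed.

Lemma stage0 x pi beta gamma psi : stage x pi beta gamma 0 psi = psi x.
Proof.
rewrite /stage Ex_start; first by rewrite disc_sumE big_ord0 mulr0 expR0 mul1r.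
apply: cyl_stage => w w' H; congr psi; exact: H.
Qed.

(** The terminal values tend to 1 and the truncated rewards to the whole, both
    uniformly in the trajectory. *)
Lemma stage_cvg x pi beta gamma (psi : nat -> E -> R) (delta : nat -> R) :
  0 <= beta < 1 -> (forall n y, `|psi n y - 1| <= delta n) -> delta @ \oo --> 0 ->
  stage x pi beta gamma n (psi n) @[n --> \oo] --> exp_reward M x pi beta gamma.
Proof.
move=> b1 pd d0; have [T T0 H] := disc_sum_unif M pi b1.
pose K := expR (`|gamma| * disc_bound M beta).
have K0 : 0 <= K by exact: expR_ge0.
apply: (@Ex_cvg _ _ _ M x pi _ _ (fun n => K * delta n + K * `|gamma| * T n)).
- move=> n; apply: (@cyl_bounded_mfun _ _ _ M n); apply: cyl_stage => w w' ww.
  by congr (psi n); exact: ww.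
- move=> n w; set s := disc_sum _ _ _ _ _; set G := discounted_reward _ _ _ _.
  have -> : expR (gamma * s) * psi n (w n) - expR (gamma * G) =
    expR (gamma * s) * (psi n (w n) - 1) + (expR (gamma * s) - expR (gamma * G)) by ring.
  have B t : `|t| <= disc_bound M beta -> gamma * t <= `|gamma| * disc_bound M beta.
    by move=> tL; apply: le_trans (ler_norm _) _; rewrite normrM ler_wpM2l.
  have sB := B _ (disc_sum_le M pi n w b1).
  have GB := B _ (discounted_reward_le M pi w b1).
  apply: le_trans (ler_normD _ _) _; apply: lerD.
    by rewrite normrM ger0_norm ?expR_ge0// ler_pM ?expR_ge0// ler_expR.
  apply: le_trans (expR_lipschitz sB GB) _.
  by rewrite -mulrA ler_wpM2l// -mulrBr normrM ler_wpM2l//; exact: H.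
- rewrite -[X in _ --> X](_ : K * 0 + K * `|gamma| * 0 = 0); last by rewrite !mulr0 addr0.
  by apply: cvgD; apply: cvgM => //; exact: cvg_cst.
Qed.

(** ** Value iteration for Markov policies *)

(** Discounting rescales the risk parameter: after one step the policy is shifted
    and [gamma] becomes [gamma * beta]. *)
Fixpoint value_iter beta m (v : nat -> E -> U) gamma z : R :=
  if m is m'.+1 then
    bellman gamma (v 0%N z) z (value_iter beta m' (fun k => v k.+1) (gamma * beta))
  else 1.

Lemma stage_value_iter x v beta gamma m n :
  stage x (markov v) beta gamma n
    (value_iter beta m (fun k => v (k + n)%N) (gamma * beta ^+ n)) =
  stage x (markov v) beta gamma (m + n) (fun=> 1).
Proof.
elim: m n => [//|m IH] n; rewrite addSnnS -IH stageS /=.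
congr (Ex _ _ _ _); apply/funext => w; congr (_ * _).
rewrite /Defs.markov tnth_mktuple/= exprSr mulrA; congr (bellman _ _ _ (value_iter _ _ _ _)).
by apply/funext => k; rewrite addSnnS.
Qed.

(** Since [value_iter] makes no reference to a law, its limit relates the laws of
    different initial states, which is how the Bellman equation is obtained. *)
Lemma value_iter_cvg x v beta gamma : 0 <= beta < 1 ->
  value_iter beta m v gamma x @[m --> \oo] --> exp_reward M x (markov v) beta gamma.
Proof.
move=> b1; rewrite (_ : (fun m => _) =
    fun m => stage x (markov v) beta gamma m (fun=> 1)).
  apply: (@stage_cvg _ _ _ _ (fun=> fun=> 1) (fun=> 0)) => //; last exact: cvg_cst.
  by move=> n y; rewrite subrr normr0.
apply/funext => m; rewrite -[m in RHS]addn0 -stage_value_iter stage0 expr0 mulr1.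
by congr (value_iter _ _ _ _ _); apply/funext => k; rewrite addn0.
Qed.

Lemma bellman_eq x v beta gamma : 0 <= beta < 1 ->
  exp_reward M x (markov v) beta gamma =
  bellman gamma (v 0%N x) x
    (fun y => exp_reward M y (markov (fun k => v k.+1)) beta (gamma * beta)).
Proof.
move=> b1; have H := @value_iter_cvg x v beta gamma b1.
rewrite -(cvg_shiftS (fun m => value_iter beta m v gamma x)) /= in H.
apply: (cvg_unique (@norm_hausdorff _ R) H).
apply: cvgM; first exact: cvg_cst.
apply: cvg_big => [|y _]; first exact: add_continuous.
by apply: cvgM; [exact: cvg_cst|exact: value_iter_cvg].
Qed.

(** The inequality is reversed because [gamma] is negative. *)
Lemma D_ge0_bellman u x a beta gamma : 0 <= beta < 1 -> gamma < 0 ->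
  (0 <= D M u x a beta gamma) =
  (exp_reward M x (markov (stationary u)) beta gamma <=
   bellman gamma a x
     (fun y => exp_reward M y (markov (stationary u)) beta (gamma * beta))).
Proof.
move=> b1 g0; rewrite /D subr_ge0 -exp_reward_le//.
by rewrite (@bellman_eq x (deviation x a u))// {1}/deviation !eqxx.
Qed.

(** With a negative risk parameter the exponential value of [u] is a
    submartingale along every policy, since the inequality holds at all the
    parameters [gamma * beta ^+ n] that occur on the way. *)
Lemma exp_reward_min u beta gamma : 0 <= beta < 1 ->
  (forall n x a, 0 <= D M u x a beta (gamma * beta ^+ n)) ->
  (forall n, gamma * beta ^+ n < 0) ->
  forall x pi, exp_reward M x (markov (stationary u)) beta gamma <=
    exp_reward M x pi beta gamma.
Proof.
move=> b1 HD Hneg x pi; have /andP[b0 bl] := b1.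
pose F n y := exp_reward M y (markov (stationary u)) beta (gamma * beta ^+ n).
pose L := disc_bound M beta.
have Fcvg : stage x pi beta gamma n (F n) @[n --> \oo] --> exp_reward M x pi beta gamma.
  apply: (@stage_cvg _ _ _ _ _ (fun n => expR (`|gamma| * L) * `|gamma| * L * beta ^+ n)) => //.
    move=> n y; have gn : `|gamma * beta ^+ n| <= `|gamma|.
      by rewrite normrM normrX (ger0_norm b0) ler_piMr// exprn_ile1// ltW.
    apply: le_trans (exp_reward_near1 y _ b1 gn) _.
    rewrite normrM normrX (ger0_norm b0) -/L.
    by rewrite [leRHS](_ : _ = expR (`|gamma| * L) * (`|gamma| * beta ^+ n * L))//; ring.
  rewrite -[X in _ --> X](mulr0 (expR (`|gamma| * L) * `|gamma| * L)).
  by apply: cvgM; [exact: cvg_cst|apply: cvg_expr; rewrite ger0_norm].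
have mono n : stage x pi beta gamma n (F n) <= stage x pi beta gamma n.+1 (F n.+1).
  rewrite stageS; apply: Ex_le.
  - apply: (@cyl_bounded_mfun _ _ _ M n); apply: cyl_stage => w w' ww.
    by congr (F n); exact: ww.
  - apply: (@cyl_bounded_mfun _ _ _ M n); apply: cyl_stage => w w' ww.
    by rewrite (ww n)// (proj2 (history_eq w w' n) ww).
  - move=> w; rewrite ler_wpM2l ?expR_ge0//.
    have := HD n (w n) (pi n (history w n)); rewrite D_ge0_bellman//.
    by rewrite -mulrA -exprSr.
have start n : F 0%N x <= stage x pi beta gamma n (F n).
  elim: n => [|n IH]; first by rewrite stage0.
  exact: le_trans IH (mono n).
have -> : exp_reward M x (markov (stationary u)) beta gamma = F 0%N x.
  by rewrite /F expr0 mulr1.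
rewrite -(cvg_lim _ Fcvg)//; apply: limr_ge; first by apply/cvg_ex; eexists; exact: Fcvg.
exact: nearW.
Qed.

Lemma util_continuous x pi beta gamma : 0 < beta < 1 ->
  util M x pi beta @ gamma --> util M x pi beta gamma.
Proof.
move=> b01; have b1 : `|beta| < 1 by rewrite ger0_norm ?ltW//; case/andP: b01.
rewrite -dsum_util// (_ : util M x pi beta = fun g => dsum (util_coef M x pi) beta g).
  have P : (fun g : R => (beta, g)) @ gamma --> (beta, gamma).
    exact: (cvg_pair (cvg_cst beta) cvg_id).
  exact: (cvg_comp _ _ P (@dsum_continuous _ _ (beta, gamma) (abs_conv_util M x pi) b1)).
by apply/funext => g; rewrite dsum_util.
Qed.

Lemma J_le_optimal beta gamma (v : nat -> E -> U) :
  (forall x pi, J M gamma x pi beta <= J M gamma x (markov v) beta) <->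
  optimal M beta gamma v.
Proof.
split=> [H x|H x pi].
  apply/eqP; rewrite eq_le; apply/andP; split.
    by apply: ereal_sup_ubound; exists (markov v).
  by apply: ge_ereal_sup => _ [pi _ <-]; rewrite lee_fin.
by rewrite -lee_fin (H x); apply: ereal_sup_ubound; exists pi.
Qed.

(** Absence of improving one-step deviations propagates to all policies because
    the interval from [r] to 0 is stable under multiplication by [beta]. The case
    [gamma = 0] is obtained as a limit from negative [gamma]. *)
Lemma optimal_iff_D_ge0 u beta r : 0 < beta < 1 -> r < 0 ->
  (forall gamma, r <= gamma <= 0 -> optimal M beta gamma (stationary u)) <->
  (forall x a gamma, r <= gamma <= 0 -> 0 <= D M u x a beta gamma).
Proof.
move=> b01 r0; have /andP[b0 bl] := b01.
have b1 : 0 <= beta < 1 by rewrite ltW.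
split=> [H x a gamma rg|HD].
  by rewrite /D subr_ge0; have /J_le_optimal := H _ rg; exact.
have neg gamma : r <= gamma < 0 -> forall x pi,
    util M x pi beta gamma <= util M x (markov (stationary u)) beta gamma.
  move=> /andP[rg g0] x pi; rewrite -J_le_util// -exp_reward_le//.
  have gn n : gamma * beta ^+ n < 0 by rewrite nmulr_rlt0 ?exprn_gt0.
  apply: exp_reward_min => // n y a; apply: HD; rewrite (ltW (gn n)) andbT.
  by apply: le_trans rg _; rewrite ler_niMr ?exprn_ile1// ltW.
move=> gamma /andP[rg g0]; apply/J_le_optimal => x pi; rewrite J_le_util//.
move: g0; rewrite le_eqVlt => /predU1P[->|g0]; last by apply: neg; rewrite rg.
rewrite leNgt; apply/negP => lt0.
set f := util M x pi beta; set h := util M x (markov (stationary u)) beta.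
have fh : (fun g => f g - h g) @ 0^'- --> f 0 - h 0.
  by apply: cvg_at_left_filter; apply: cvgB; exact: util_continuous.
have d0 : 0 < f 0 - h 0 by rewrite subr_gt0.
have near0 : \forall g \near 0^'-, h g < f g /\ r <= g < 0.
  near=> g; split; last first.
    apply/andP; split; near: g; [exact: nbhs_left_ge|exact: nbhs_left_lt].
  by rewrite -subr_gt0; near: g; exact: cvgr_gt d0.
case: (@filter_ex _ _ (at_left_proper_filter 0) _ near0) => g [fg rg_].
by have := neg g rg_ x pi; rewrite leNgt fg.
Unshelve. all: by end_near.
Qed.

End Verification.

(** * The branch of zeros and the critical risk parameter *)

Section Branch.
Context {R : realType}.

(** The local picture at a simple zero: to the right of the branch [f] the
    series is nonnegative, to its left it is negative. *)
Lemma implicit_branch (a : nat -> nat -> R) (beta0 gamma0 delta0 : R) :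
  abs_conv a -> 0 < beta0 < 1 -> dsum a beta0 gamma0 = 0 ->
  0 < dsum_deriv a beta0 gamma0 -> 0 < delta0 ->
  exists rho delta : R, exists f : R -> R,
    [/\ 0 < rho, 0 < delta <= delta0, f beta0 = gamma0 &
      forall beta, `|beta - beta0| < rho ->
        [/\ `|f beta - gamma0| < delta, analytic_at f beta, {for beta, continuous f} &
          forall gamma, `|gamma - gamma0| <= delta ->
            (0 <= dsum a beta gamma) = (f beta <= gamma)]].
Proof.
move=> ac b01 a0 q0 delta00; have /andP[b0 b1] := b01.
have bl : 0 <= beta0 < 1 by rewrite ltW.
set q := dsum_deriv a beta0 gamma0 in q0.
have [K K0 HK] := dsum_increment gamma0 ac bl.
pose delta := Num.min (Num.min 1 delta0) (q / (2 * (K + 1))).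
have d0 : 0 < delta by rewrite !lt_min ltr01 delta00 divr_gt0// mulr_gt0//; lra.
have d1 : delta <= 1 by rewrite !ge_min lexx.
have dd0 : delta <= delta0 by rewrite !ge_min lexx orbT.
have dK : delta * K <= q / 2.
  have : delta <= q / (2 * (K + 1)) by rewrite ge_min lexx orbT.
  rewrite ler_pdivlMr ?mulr_gt0//; [nra|lra].
have bp : 0 < (1 - beta0) / 2 by rewrite divr_gt0// subr_gt0.
have mono beta gamma gamma' : `|beta - beta0| < delta * ((1 - beta0) / 2) ->
    `|gamma - gamma0| <= delta -> `|gamma' - gamma0| <= delta -> gamma <= gamma' ->
    q / 2 * (gamma' - gamma) <= dsum a beta gamma' - dsum a beta gamma.
  move=> hb hg hg' gg; have d01 : 0 <= delta <= 1 by rewrite ltW.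
  have := HK _ _ _ _ d01 (ltW hb) hg hg'; rewrite -/q [`|gamma' - _|]ger0_norm ?subr_ge0//.
  have : delta * K * (gamma' - gamma) <= q / 2 * (gamma' - gamma).
    by rewrite ler_wpM2r// subr_ge0.
  by rewrite ler_norml => H /andP[H' _]; nra.
have nq : dsum_deriv a beta0 gamma0 != 0 by rewrite gt_eqF.
have d20 : 0 < delta / 2 by rewrite divr_gt0.
have [rho1 rho10 [f Hf]] := implicit_analytic ac bl a0 nq d20.
pose rho := Num.min rho1 (delta * ((1 - beta0) / 2)).
have rho0 : 0 < rho by rewrite lt_min rho10 mulr_gt0.
have R1 beta : `|beta - beta0| < rho -> `|beta - beta0| < rho1.
  by rewrite lt_min => /andP[].
have R2 beta : `|beta - beta0| < rho -> `|beta - beta0| < delta * ((1 - beta0) / 2).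
  by rewrite lt_min => /andP[].
have fd beta : `|beta - beta0| < rho -> `|f beta - gamma0| <= delta.
  by move=> /R1/Hf[+ _ _]; lra.
have sgn beta gamma : `|beta - beta0| < rho -> `|gamma - gamma0| <= delta ->
    (0 <= dsum a beta gamma) = (f beta <= gamma).
  move=> hb hg; have [_ fz _] := Hf _ (R1 _ hb).
  apply/idP/idP => [|fg].
    apply: contraLR; rewrite -!ltNge => gf.
    have := mono _ _ _ (R2 _ hb) hg (fd _ hb) (ltW gf); rewrite fz; nra.
  have := mono _ _ _ (R2 _ hb) (fd _ hb) hg fg; rewrite fz; nra.
exists rho, delta, f; split=> //; first by rewrite d0.
  have h0 : `|beta0 - beta0| < rho by rewrite subrr normr0.
  have g0 : `|gamma0 - gamma0| <= delta by rewrite subrr normr0 ltW.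
  have [_ fz _] := Hf _ (R1 _ h0).
  have := sgn _ _ h0 g0; rewrite a0 lexx => /esym fg.
  have := mono _ _ _ (R2 _ h0) (fd _ h0) g0 fg; rewrite fz a0 => H.
  by apply/eqP; rewrite eq_le fg/=; nra.
move=> beta hb; have [fd2 fz fa] := Hf _ (R1 _ hb).
split=> //; [lra| |by move=> gamma; exact: sgn].
apply/cvgrPdist_lt => e e0.
have qe : 0 < q / 2 * e by rewrite mulr_gt0// divr_gt0.
have bb1 : `|beta| < 1.
  have := R2 _ hb; rewrite ltr_norml => /andP[h1 h2].
  rewrite ltr_norml; apply/andP; split; nra.
have P : (fun b : R => (b, f beta)) @ beta --> (beta, f beta).
  exact: (cvg_pair cvg_id (cvg_cst (f beta))).
have C : (fun b => dsum a b (f beta)) @ beta --> dsum a beta (f beta).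
  exact: (cvg_comp _ _ P (@dsum_continuous _ a (beta, f beta) ac bb1)).
have Dz : \forall b \near beta, `|dsum a b (f beta)| < q / 2 * e.
  have : \forall b \near beta, `|dsum a beta (f beta) - dsum a b (f beta)| < q / 2 * e.
    by move/cvgrPdist_lt: C => /(_ _ qe).
  by apply: filterS => b; rewrite fz sub0r normrN.
have hb' : \forall b \near beta, `|b - beta0| < rho.
  have : (fun b => b - beta0) @ beta --> beta - beta0 by apply: cvgB => //; exact: cvg_cst.
  by move/cvgr_norm_lt => /(_ _ hb).
near=> b; have hbb : `|b - beta0| < rho by near: b.
have Db : `|dsum a b (f beta)| < q / 2 * e by near: b.
have [_ fzb _] := Hf _ (R1 _ hbb).
have q2 : 0 < q / 2 by rewrite divr_gt0.
rewrite -(ltr_pM2l q2); apply: le_lt_trans Db.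
have [fle|/ltW fle] := leP (f b) (f beta).
  rewrite ger0_norm ?subr_ge0//; apply: le_trans (ler_norm _).
  by have := mono _ _ _ (R2 _ hbb) (fd _ hbb) (fd _ hb) fle; rewrite fzb subr0.
rewrite distrC ger0_norm ?subr_ge0// -normrN; apply: le_trans (ler_norm _).
by have := mono _ _ _ (R2 _ hbb) (fd _ hb) (fd _ hbb) fle; rewrite fzb sub0r.
Unshelve. all: by end_near.
Qed.

Lemma analytic_at_near (f g : R -> R) x :
  analytic_at f x -> (\forall y \near x, f y = g y) -> analytic_at g x.
Proof.
move=> [a [r [r0 H]]] /nbhs_ballP[e /= e0 fg]; exists a, (Num.min r e); split.
  by rewrite lt_min r0.
move=> y; rewrite lt_min => /andP[yr ye]; rewrite -fg; first exact: H.
by rewrite -ball_normE /ball_/= distrC.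
Qed.

End Branch.

Section Deviations.
Context {R : realType} {E U : finType} (M : mdp R E U).
Implicit Types (u : {ffun E -> U}) (x : E) (a : U) (beta gamma : R).

(** The gain in exponential utility of [u] over its deviation has the sign of
    [D], and unlike [D] it is given by one power series, at [gamma = 0] too. *)
Definition gain_coef u x a : nat -> nat -> R := fun j k =>
  util_coef M x (markov (stationary u)) j k - util_coef M x (markov (deviation x a u)) j k.

Definition gain u x a : R -> R -> R := dsum (gain_coef u x a).

Lemma abs_conv_gain u x a : abs_conv (gain_coef u x a).
Proof. by apply: abs_convB; exact: abs_conv_util. Qed.

Lemma gainE u x a beta gamma : 0 < beta < 1 -> gain u x a beta gamma =
  util M x (markov (stationary u)) beta gamma -
  util M x (markov (deviation x a u)) beta gamma.
Proof.
move=> b01; rewrite /gain dsumB ?dsum_util//; try exact: abs_conv_util.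
by case/andP: b01 => b0 b1; rewrite ger0_norm// ltW.
Qed.

Lemma D_ge0_gain u x a beta gamma : 0 < beta < 1 ->
  (0 <= D M u x a beta gamma) = (0 <= gain u x a beta gamma).
Proof.
move=> b01; have /andP[b0 b1] := b01.
by rewrite gainE// !subr_ge0 J_le_util// ltW.
Qed.

Lemma D_gt0_gain u x a beta gamma : 0 < beta < 1 ->
  (0 < D M u x a beta gamma) = (0 < gain u x a beta gamma).
Proof.
move=> b01; have /andP[b0 b1] := b01.
by rewrite gainE// !subr_gt0 !ltNge J_le_util// ltW.
Qed.

Lemma D_eq0_gain u x a beta gamma : 0 < beta < 1 ->
  D M u x a beta gamma = 0 -> gain u x a beta gamma = 0.
Proof.
move=> b01 D0; apply/eqP; rewrite eq_le -D_ge0_gain// D0 lexx andbT.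
by rewrite leNgt -D_gt0_gain// D0 ltxx.
Qed.

Lemma gain_same u x beta gamma : 0 < beta < 1 -> gain u x (u x) beta gamma = 0.
Proof.
move=> b01; rewrite gainE// (_ : deviation x (u x) u = stationary u) ?subrr//.
by apply/funext => n; apply/funext => y; rewrite /deviation; case: andP => // -[_ /eqP ->].
Qed.

Lemma gain_continuous u x a (z : R * R) : 0 < z.1 < 1 ->
  (fun z : R * R => gain u x a z.1 z.2) @ z --> gain u x a z.1 z.2.
Proof.
move=> /andP[b0 b1]; apply: dsum_continuous; first exact: abs_conv_gain.
by rewrite ger0_norm// ltW.
Qed.

Lemma ln_lipschitz (c s t : R) : 0 < c -> c <= s -> c <= t ->
  `|ln s - ln t| <= c^-1 * `|s - t|.
Proof.
move=> c0; wlog st : s t / t <= s => [H cs ct|cs ct].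
  have [ts|/ltW st] := leP t s; first exact: H.
  by rewrite distrC [X in _ * X]distrC; exact: H.
have t0 := lt_le_trans c0 ct; have s0 := lt_le_trans c0 cs.
rewrite !ger0_norm ?subr_ge0 ?ler_ln ?posrE// -ln_div ?posrE//.
have -> : s / t = 1 + (s - t) / t by rewrite mulrBl divff ?gt_eqF// addrC subrK.
apply: le_trans (le_ln1Dx _) _.
  by apply: (@lt_le_trans _ _ 0); rewrite ?ltrN10// divr_ge0 ?subr_ge0// ltW.
by rewrite mulrC ler_wpM2r ?subr_ge0// lef_pV2.
Qed.

(** Logarithms are Lipschitz on the range of the exponential values. *)
Lemma D_le_gain u x a beta gamma : 0 < beta < 1 -> gamma != 0 ->
  `|D M u x a beta gamma| <= expR (`|gamma| * disc_bound M beta) * `|gain u x a beta gamma|.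
Proof.
move=> b01 g0; have /andP[b0 b1] := b01; have bl : 0 <= beta < 1 by rewrite ltW.
rewrite /D !J_exp_reward// (negbTE g0) -mulrBr normrM normfV ler_pdivrMl ?normr_gt0//.
have lo p := proj1 (andP (exp_reward_bounds M x p gamma bl)).
apply: le_trans (ln_lipschitz (expR_gt0 _) (lo _) (lo _)) _.
rewrite expRN invrK [leRHS]mulrCA ler_wpM2l ?expR_ge0// !exp_rewardE// gainE//.
by rewrite opprD addrACA subrr add0r -mulrBr normrM.
Qed.

(** If the derivative of the gain vanished, the gain would be [O(h ^+ 2)] at its
    zero, and so would [D], which is bounded by a multiple of it. *)
Lemma gain_deriv_neq0 u x a beta gamma : 0 < beta < 1 -> gamma < 0 ->
  D M u x a beta gamma = 0 -> derive1 (D M u x a beta) gamma != 0 ->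
  dsum_deriv (gain_coef u x a) beta gamma != 0.
Proof.
move=> b01 g0 D0; have /andP[b0 b1] := b01; have bl : 0 <= beta < 1 by rewrite ltW.
apply: contraNneq => q0; rewrite /derive1.
have [K K0 HK] := dsum_increment gamma (abs_conv_gain u x a) bl.
have L0 := disc_bound_ge0 M b1.
pose C := expR ((`|gamma| + 1) * disc_bound M beta) * K.
have C0 : 0 <= C by rewrite mulr_ge0 ?expR_ge0.
apply/eqP; apply: cvg_lim => //; apply/cvgrPdist_lt => e e0.
have m0 : 0 < Num.min (- gamma) (Num.min 1 (e / (C + 1))).
  by rewrite !lt_min oppr_gt0 g0 ltr01 divr_gt0// ltr_wpDl.
near=> h.
have h0 : h != 0 by near: h; exact: nbhs_dnbhs_neq.
have : `|h| < Num.min (- gamma) (Num.min 1 (e / (C + 1))).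
  near: h; apply: nbhs_dnbhs; have := @nbhs0_lt _ R _ m0; exact.
rewrite !lt_min => /and3P[hg h1 he].
have hn : 0 < `|h| by rewrite normr_gt0.
have gh : h + gamma != 0.
  by rewrite lt_eqF//; have := ler_norm h; lra.
have := D_le_gain u x a b01 gh.
have h01 : 0 <= `|h| <= 1 by rewrite normr_ge0 ltW.
have bb0 : `|beta - beta| <= `|h| * ((1 - beta) / 2).
  by rewrite subrr normr0 mulr_ge0// divr_ge0// subr_ge0 ltW.
have hh : `|h + gamma - gamma| <= `|h| by rewrite addrK.
have gg : `|gamma - gamma| <= `|h| by rewrite subrr normr0.
have := HK _ _ _ _ h01 bb0 gg hh; rewrite q0 mul0r subr0 addrK -/(gain _ _ _ _ _).
rewrite -/(gain u x a beta gamma) (D_eq0_gain b01 D0) subr0 => Hgain HD.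
have eC : expR (`|h + gamma| * disc_bound M beta) <=
    expR ((`|gamma| + 1) * disc_bound M beta).
  rewrite ler_expR ler_wpM2r//; have := ler_normD h gamma; lra.
have HD2 : `|D M u x a beta (h + gamma)| <= C * `|h| * `|h|.
  apply: le_trans HD _; rewrite /C -!mulrA; apply: ler_pM; rewrite ?expR_ge0//.
  by rewrite mulrA [K * _]mulrC.
rewrite sub0r normrN D0 subr0 normrM normfV ltr_pdivrMl// mulrC.
apply: le_lt_trans HD2 _; rewrite ltr_pM2r//.
move: he; rewrite ltr_pdivlMr; last by rewrite ltr_wpDl.
by apply: le_lt_trans; rewrite mulrC ler_wpM2l// lerDl.
Unshelve. all: by end_near.
Qed.

(** ** The critical risk parameter *)

(** In terms of the gain, so that continuity in both parameters applies. *)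
Definition never_improved u beta r :=
  forall x a gamma, r <= gamma <= 0 -> 0 <= gain u x a beta gamma.

Lemma optimal_iff_never_improved u beta r : 0 < beta < 1 -> r < 0 ->
  (forall gamma, r <= gamma <= 0 -> optimal M beta gamma (stationary u)) <->
  never_improved u beta r.
Proof.
move=> b01 r0; split=> [/(optimal_iff_D_ge0 M u b01 r0) H x a gamma rg|H].
  by rewrite -D_ge0_gain//; exact: H.
by apply/(optimal_iff_D_ge0 M u b01 r0) => x a gamma rg; rewrite D_ge0_gain//; exact: H.
Qed.

Lemma gamma_crit_le u beta r : 0 < beta < 1 -> r < 0 -> never_improved u beta r ->
  (gamma_crit M beta <= r%:E)%E.
Proof.
move=> b01 r0 H; apply: ereal_inf_lbound; exists r => //; split=> //.
by exists u; apply/optimal_iff_never_improved.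
Qed.

Lemma gamma_crit_ge beta s : 0 < beta < 1 ->
  (forall u r, r < 0 -> never_improved u beta r -> s <= r) ->
  (s%:E <= gamma_crit M beta)%E.
Proof.
move=> b01 H; apply: le_ereal_inf_tmp => _ [r [r0 [u Hu]] <-].
by rewrite lee_fin; apply: (H u) => //; apply/optimal_iff_never_improved.
Qed.

Lemma gamma_crit_lt0 beta gamma0 : gamma_crit M beta = gamma0%:E -> gamma0 < 0.
Proof.
move=> H; have /ereal_inf_lt[_ [r [r0 ru] <-] _] : (gamma_crit M beta < +oo)%E.
  by rewrite H ltry.
apply: (le_lt_trans _ r0); rewrite -lee_fin -H; apply: ereal_inf_lbound.
by exists r => //; split.
Qed.

(** The critical parameter is at most the [rho] of [u0], which is smaller than
    that of [u]; the failure of [u] at a parameter in between is witnessed by a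
    deviation. *)
Lemma improved_above u0 u beta gamma0 : 0 < beta < 1 ->
  gamma_crit M beta = gamma0%:E -> (rho M u0 beta < rho M u beta)%E ->
  exists x a gamma, gamma0 < gamma <= 0 /\ gain u x a beta gamma < 0.
Proof.
move=> b01 hg huu; have g0 := gamma_crit_lt0 hg.
have grho : (gamma0%:E < rho M u beta)%E.
  apply: le_lt_trans huu; apply: le_ereal_inf_tmp => _ [r [r0 Hr] <-].
  have [rn|rn] := ltP r 0; last by rewrite lee_fin (le_trans (ltW g0)).
  rewrite -hg; apply: (gamma_crit_le (u := u0)) => // x a gamma rg.
  by rewrite -D_ge0_gain//; exact: Hr.
have [r [gr rrho r0]] : exists r : R, [/\ gamma0 < r, (r%:E < rho M u beta)%E & r <= 0].
  case rhoE: (rho M u beta) grho => [s| |] //=; last by exists (gamma0 / 2); split; rewrite ?ltry//; lra.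
  rewrite lte_fin => gs; exists (Num.min ((gamma0 + s) / 2) 0).
  rewrite lt_min g0 andbT lte_fin gt_min ge_min lexx orbT; split=> //; first lra.
  by apply/orP; left; lra.
apply: contrapT => H; move: rrho; apply/negP; rewrite -leNgt.
apply: ereal_inf_lbound; exists r => //; split=> // x a gamma /andP[rg gle].
rewrite D_ge0_gain// leNgt; apply/negP => lt0; apply: H; exists x, a, gamma.
by rewrite (lt_le_trans gr rg).
Qed.

End Deviations.

(** * Analyticity of the critical risk parameter *)

Theorem proposition4p4 (R : realType) (E U : finType) (M : mdp R E U)
  (beta0 gamma0 : R)
  (hbeta0 : 0 < beta0 < 1)
  (hgamma0 : gamma_crit M beta0 = gamma0%:E)
  (u0 : {ffun E -> U}) (x0 : E) (a0 : U)
  (hrho : (rho M u0 beta0 <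
           \big[mine/+oo]_(u : {ffun E -> U} | u != u0) rho M u beta0)%E)
  (ha0 : a0 != u0 x0)
  (hD0 : D M u0 x0 a0 beta0 gamma0 = 0)
  (hDpos : forall gamma : R, gamma0 < gamma <= 0 ->
     0 < D M u0 x0 a0 beta0 gamma)
  (hDother : forall (gamma : R) (x : E) (a : U), gamma0 <= gamma <= 0 ->
     a != u0 x -> (x, a) != (x0, a0) -> 0 < D M u0 x a beta0 gamma)
  (hderiv : derive1 (D M u0 x0 a0 beta0) gamma0 != 0) :
  (exists (V : set R) (ghat : R -> R),
     [/\ open V, V beta0, V `<=` `]0, 1[ &
       [/\ forall beta, V beta -> ghat beta < 0,
           forall beta, V beta -> analytic_at ghat beta,
           ghat beta0 = gamma0 &
           forall beta, V beta -> gamma_crit M beta = (ghat beta)%:E]]) /\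
  (\forall beta \near beta0,
     [/\ {for beta, continuous (gamma_crit M)},
         gamma_crit M beta \is a fin_num &
         analytic_at (fine \o gamma_crit M) beta]).
Proof.
have g0 := gamma_crit_lt0 hgamma0; have /andP[b0 b1] := hbeta0.
have crit0 : gain M u0 x0 a0 beta0 gamma0 = 0 by exact: D_eq0_gain.
have critpos gamma : gamma0 < gamma <= 0 -> 0 < gain M u0 x0 a0 beta0 gamma.
  by move=> /hDpos; rewrite D_gt0_gain.
(* The gain is positive to the right of its zero gamma0, so its nonzero derivative
   there is positive: if it were negative, so would be the gain at distance h. *)
have q_gt0 : 0 < dsum_deriv (gain_coef M u0 x0 a0) beta0 gamma0.
  rewrite lt_neqAle eq_sym (gain_deriv_neq0 hbeta0 g0 hD0 hderiv)/=.
  rewrite leNgt; apply/negP; set q := dsum_deriv _ _ _ => q0.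
  have bl : 0 <= beta0 < 1 by rewrite ltW.
  have [K K0 HK] := dsum_increment gamma0 (abs_conv_gain M u0 x0 a0) bl.
  pose h := Num.min (Num.min 1 (- gamma0)) (- q / (K + 1)).
  have h0 : 0 < h.
    by rewrite !lt_min ltr01 oppr_gt0 g0 divr_gt0 ?oppr_gt0// ltr_wpDl.
  have h1 : h <= 1 by rewrite !ge_min lexx.
  have hg : h <= - gamma0 by rewrite !ge_min lexx orbT.
  have hK : h * (K + 1) <= - q by rewrite -ler_pdivlMr ?ltr_wpDl// !ge_min lexx orbT.
  have h01 : 0 <= h <= 1 by rewrite ltW.
  have bb0 : `|beta0 - beta0| <= h * ((1 - beta0) / 2).
    by rewrite subrr normr0 mulr_ge0 ?divr_ge0 ?subr_ge0// ltW.
  have hh : `|h + gamma0 - gamma0| <= h by rewrite addrK ger0_norm// ltW.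
  have gg : `|gamma0 - gamma0| <= h by rewrite subrr normr0 ltW.
  have := HK _ _ _ _ h01 bb0 gg hh; rewrite addrK (ger0_norm (ltW h0)).
  rewrite -/q -!/(gain _ _ _ _ _ _) crit0 subr0 ler_norml => /andP[_].
  have : 0 < gain M u0 x0 a0 beta0 (h + gamma0).
    by apply: critpos; apply/andP; split; lra.
  nra.
have d01 : 0 < Num.min 1 (- gamma0 / 2) by rewrite lt_min ltr01 divr_gt0// oppr_gt0.
have [rho1 [delta [f [rho0 /andP[d0 dmin] f0 Hf]]]] :=
  implicit_branch (abs_conv_gain M u0 x0 a0) hbeta0 crit0 q_gt0 d01.
have {dmin} [d1 dg] : delta <= 1 /\ delta <= - gamma0 / 2.
  by move: dmin; rewrite le_min => /andP[].
have near_rho : \forall beta \near beta0, `|beta - beta0| < rho1.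
  have : (fun b => b - beta0) @ beta0 --> beta0 - beta0.
    by apply: cvgB => //; exact: cvg_cst.
  by move/cvgr_norm_lt => /(_ rho1); rewrite subrr normr0; exact.
have near01 : \forall beta \near beta0, 0 < beta < 1.
  by near=> beta; apply/andP; split; near: beta; [exact: lt_nbhsr|exact: lt_nbhsl].
have fcont : f @ beta0 --> f beta0.
  by have [|_ _ + _] := Hf beta0; rewrite ?subrr ?normr0.
have gcont u x a gamma : (fun z : R * R => gain M u x a z.1 z.2) @ (beta0, gamma) -->
    gain M u x a beta0 gamma.
  exact: (@gain_continuous _ _ _ M u x a (beta0, gamma)).
(* No deviation improves u0 to the right of the branch. The compact set reaches
   below gamma0, so that it contains the branch for nearby discount factors. *)
have good : \forall beta \near beta0, forall gamma, gamma0 - 1 <= gamma <= 0 ->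
    f beta <= gamma -> forall x a, 0 <= gain M u0 x a beta gamma.
  have cover := (@compact_near_coveringP _ _).1 (@segment_compact R (gamma0 - 1) 0).
  have pos x a gamma1 : 0 < gain M u0 x a beta0 gamma1 ->
      \forall z \near (gamma1, beta0), 0 <= gain M u0 x a z.2 z.1.
    move=> gpos.
    have P : (fun z : R * R => (z.2, z.1)) @ (gamma1, beta0) --> (beta0, gamma1).
      exact: (cvg_pair cvg_snd cvg_fst).
    have C : (fun z : R * R => gain M u0 x a z.2 z.1) @ (gamma1, beta0) -->
        gain M u0 x a beta0 gamma1 by exact: (cvg_comp _ _ P (gcont u0 x a gamma1)).
    by move/cvgr_gt: C => /(_ _ gpos); apply: filterS => z /ltW.
  have fst1 (gamma1 : R) : (fun z : R * R => z.1) @ (gamma1, beta0) --> gamma1.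
    exact: cvg_fst.
  have snd1 (gamma1 : R) Q : (\forall beta \near beta0, Q beta) ->
      \forall z \near (gamma1, beta0), Q z.2.
    have S : (fun z : R * R => z.2) @ (gamma1, beta0) --> beta0 by exact: cvg_snd.
    exact: S.
  have H : forall gamma1, gamma0 - 1 <= gamma1 <= 0 ->
      \forall gamma \near gamma1 & beta \near beta0, gamma <= 0 -> f beta <= gamma ->
        forall x a, 0 <= gain M u0 x a beta gamma.
    move=> gamma1 /andP[_ g10]; have [lt10|le01] := ltP gamma1 gamma0.
      pose c := (gamma1 + gamma0) / 2.
      have n1 : \forall z \near (gamma1, beta0), z.1 < c.
        by have /cvgr_lt := fst1 gamma1; move/(_ c); apply; rewrite /c; lra.
      have n2 : \forall z \near (gamma1, beta0), c < f z.2.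
        apply: (snd1 _ (fun beta => c < f beta)).
        by move/cvgr_gt: fcont => /(_ c); apply; rewrite f0 /c; lra.
      near=> z => _ fz; have z1 : z.1 < c by near: z.
      have z2 : c < f z.2 by near: z.
      by have := lt_trans z1 z2; rewrite ltNge fz.
    have Hxa (xa : E * U) : \forall z \near (gamma1, beta0), f z.2 <= z.1 ->
        0 <= gain M u0 xa.1 xa.2 z.2 z.1.
      case: xa => x a /=; have [->|au] := eqVneq a (u0 x).
        have n1 := snd1 gamma1 _ near01.
        by near=> z => _; rewrite gain_same//; near: z.
      have [[-> ->]|xa] := eqVneq (x, a) (x0, a0); last first.
        have gpos : 0 < gain M u0 x a beta0 gamma1.
          by rewrite -D_gt0_gain//; apply: hDother => //; rewrite le01.
        by near=> z => _; near: z; exact: pos.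
      move: le01; rewrite le_eqVlt => /predU1P[<-|lt01]; last first.
        have gpos : 0 < gain M u0 x0 a0 beta0 gamma1 by apply: critpos; rewrite lt01.
        by near=> z => _; near: z; exact: pos.
      have n1 := snd1 gamma0 _ near_rho.
      have n2 : \forall z \near (gamma0, beta0), `|z.1 - gamma0| <= delta.
        have : (fun z : R * R => z.1 - gamma0) @ (gamma0, beta0) --> gamma0 - gamma0.
          exact: (cvgB (fst1 gamma0) (cvg_cst gamma0)).
        by move/cvgr_norm_le => /(_ delta); rewrite subrr normr0; apply.
      near=> z; have z1 : `|z.2 - beta0| < rho1 by near: z.
      have z2 : `|z.1 - gamma0| <= delta by near: z.
      by have [_ _ _ sgn] := Hf _ z1; rewrite /gain sgn.
    have Hall : \forall z \near (gamma1, beta0), forall xa : E * U,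
        f z.2 <= z.1 -> 0 <= gain M u0 xa.1 xa.2 z.2 z.1 by exact: (filter_forall _ Hxa).
    near=> z => _ fz x a.
    have Hz : forall xa : E * U, f z.2 <= z.1 -> 0 <= gain M u0 xa.1 xa.2 z.2 z.1.
      by near: z.
    exact: (Hz (x, a)).
  have K : \forall beta \near beta0, `[gamma0 - 1, 0] `<=` (fun gamma => gamma <= 0 ->
      f beta <= gamma -> forall x a, 0 <= gain M u0 x a beta gamma).
    apply: (cover R (nbhs beta0) (fun beta gamma => gamma <= 0 -> f beta <= gamma ->
      forall x a, 0 <= gain M u0 x a beta gamma)) => gamma1 /=; rewrite in_itv/=.
    exact: H.
  near=> beta => gamma gr.
  have Kb : `[gamma0 - 1, 0] `<=` (fun gamma => gamma <= 0 ->
      f beta <= gamma -> forall x a, 0 <= gain M u0 x a beta gamma) by near: beta.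
  by apply: Kb; rewrite /= ?in_itv//; case/andP: gr.
(* A strict improvement over u at a parameter above gamma0 persists for nearby
   discount factors, and remains above the branch. *)
have bad1 u : \forall beta \near beta0, u != u0 -> exists x a gamma,
    f beta < gamma <= 0 /\ gain M u x a beta gamma < 0.
  have [->|uu] := eqVneq u u0; first by near=> beta.
  have [x [a [gamma [/andP[gg gle] lt0]]]] : exists x a gamma,
      gamma0 < gamma <= 0 /\ gain M u x a beta0 gamma < 0.
    apply: (improved_above (u0 := u0)) => //; apply: lt_le_trans hrho _.
    exact: bigmin_le_cond.
  have P : (fun b : R => (b, gamma)) @ beta0 --> (beta0, gamma).
    exact: (cvg_pair cvg_id (cvg_cst gamma)).
  have C : (fun b => gain M u x a b gamma) @ beta0 --> gain M u x a beta0 gamma.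
    exact: (cvg_comp _ _ P (gcont u x a gamma)).
  have lt1 : \forall beta \near beta0, gain M u x a beta gamma < 0.
    by move/cvgr_lt: C => /(_ _ lt0).
  have lt2 : \forall beta \near beta0, f beta < gamma.
    by move/cvgr_lt: fcont => /(_ gamma); rewrite f0; exact.
  near=> beta => _; exists x, a, gamma; rewrite gle andbT.
  by split; near: beta.
have bad : \forall beta \near beta0, forall u, u != u0 -> exists x a gamma,
    f beta < gamma <= 0 /\ gain M u x a beta gamma < 0.
  exact: (filter_forall _ bad1).
have main : \forall beta \near beta0, [/\ 0 < beta < 1, `|beta - beta0| < rho1,
    f beta < 0 & gamma_crit M beta = (f beta)%:E].
  near=> beta.
  have b01 : 0 < beta < 1 by near: beta.
  have hb : `|beta - beta0| < rho1 by near: beta.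
  have [fd _ _ sgn] := Hf _ hb.
  move: (fd); rewrite ltr_norml => /andP[fd1 fd2].
  have fneg : f beta < 0 by lra.
  split=> //; apply/eqP; rewrite eq_le; apply/andP; split.
    apply: (gamma_crit_le (u := u0)) => // x a gamma /andP[fg g00].
    have goodb : forall gamma, gamma0 - 1 <= gamma <= 0 ->
      f beta <= gamma -> forall x a, 0 <= gain M u0 x a beta gamma by near: beta.
    by apply: goodb => //; apply/andP; split=> //; lra.
  apply: gamma_crit_ge => // u r r0 Hr; rewrite leNgt; apply/negP => rf.
  have [uu|uu] := eqVneq u u0.
    (* Below the branch, but within delta of gamma0, a0 improves u0. *)
    pose gamma := Num.max r (gamma0 - delta).
    have rg : r <= gamma by rewrite le_max lexx.
    have dg' : gamma0 - delta <= gamma by rewrite le_max lexx orbT.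
    have gf : gamma < f beta by rewrite gt_max rf; lra.
    have near0 : `|gamma - gamma0| <= delta by rewrite ler_norml; apply/andP; split; lra.
    have : 0 <= gain M u0 x0 a0 beta gamma.
      by rewrite -uu; apply: Hr; rewrite rg; lra.
    by rewrite /gain sgn// leNgt gf.
  have badb : forall u, u != u0 -> exists x a gamma,
    f beta < gamma <= 0 /\ gain M u x a beta gamma < 0 by near: beta.
  have [x [a [gamma [/andP[fg gle]]]]] := badb u uu.
  by rewrite ltNge Hr// gle (ltW (lt_trans rf fg)).
have [V [oV Vb0] HV] : exists2 V : set R, open_nbhs beta0 V & V `<=`
    (fun beta => [/\ 0 < beta < 1, `|beta - beta0| < rho1,
      f beta < 0 & gamma_crit M beta = (f beta)%:E]).
  have : nbhs beta0 (fun beta => [/\ 0 < beta < 1, `|beta - beta0| < rho1,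
      f beta < 0 & gamma_crit M beta = (f beta)%:E]) by exact: main.
  by rewrite nbhsE => -[V oV HV]; exists V.
split.
  exists V, f; split=> //.
    by move=> beta /HV[b01 _ _ _]; rewrite /= in_itv.
  split=> // beta /HV[_ hb fneg cr] //.
  by have [] := Hf _ hb.
near=> beta.
have Vb : V beta by near: beta; exact: open_nbhs_nbhs.
have [_ hb _ cr] := HV _ Vb; have [_ fa fc _] := Hf _ hb.
have crnear : \forall b \near beta, gamma_crit M b = (f b)%:E.
  have : nbhs beta V by exact: open_nbhs_nbhs.
  by apply: filterS => b /HV[].
split; last 2 first.
- by rewrite cr.
- by apply: (analytic_at_near fa); move: crnear; apply: filterS => b /= ->.
suff : gamma_crit M @ beta --> gamma_crit M beta by [].
rewrite cr.
have fE : (fun b => (f b)%:E) @ beta --> (f beta)%:E by apply: cvg_EFin => //; near=> b.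
apply: cvg_trans fE; apply: near_eq_cvg.
by move: crnear; apply: filterS => b /= ->.
Unshelve. all: by end_near.
Qed.
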